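(* Let $\nu\in(0,1]$ and $p=1+\nu$. Let $f:\mathbb{R}^n\to\mathbb{R}$ be Fréchet differentiable with $\nu$-Hölder continuous gradient on $\mathbb{R}^n$ with constant $L_\nu$, let $g:\mathbb{R}^n\to\mathbb{R}\cup\{+\infty\}$ be proper and lower semicontinuous, and set $\varphi:=f+g$. Let $\overline{x}=0$ be a $p$-calm point of $\varphi$ with $\varphi(\overline{x})=0$, and let $g$ be prox-regular at $\overline{x}=0$ for $-\nabla f(\overline{x})\in\partial g(\overline{x})$. Suppose $f\in\mathcal{C}^2(U)$ on an open neighborhood $U$ of $\overline{x}$. Then there exists $\overline{\gamma}>0$ such that for each $\gamma\in(0,\overline{\gamma})$ there exists $r>0$ such that: (a) $\varphi_\gamma^p\in\mathcal{C}^1(\mathbf{B}(0;r))$; (b) if moreover $f\in\mathcal{C}^{2,\mu}_{L_\mu}(U)$ for some $L_\mu>0$ with $\mu\in(0,1)$, then, setting $\eta=\min\{\mu,\nu^2/2\}$, there exists $L_\eta>0$ such that for each $x_1,x_2\in\mathbf{B}(0;r)$, $$\|\nabla\varphi_\gamma^p(x_2)-\nabla\varphi_\gamma^p(x_1)\|\le L_\eta\|x_2-x_1\|^\eta.$$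
   Context: $\|\cdot\|$ and $\langle\cdot,\cdot\rangle$ are the Euclidean norm and inner product on $\mathbb{R}^n$; $\mathbf{B}(\overline{x};r)$ is the open ball with center $\overline{x}$ and radius $r$. A function $h:\mathbb{R}^n\to\mathbb{R}\cup\{+\infty\}$ is proper if it is finite at some point. $\mathcal{C}^k(U)$ denotes the functions that are $k$-times continuously differentiable on $U$; $\mathcal{C}^{2,\mu}_{L_\mu}(U)$ denotes the twice differentiable functions on $U$ whose second derivative is $\mu$-Hölder continuous on $U$ with constant $L_\mu$, i.e. $\|\nabla^2f(x)-\nabla^2f(y)\|\le L_\mu\|x-y\|^\mu$ for $x,y\in U$. $f$ has a $\nu$-Hölder continuous gradient with constant $L_\nu\ge 0$ if $\|\nabla f(y)-\nabla f(x)\|\le L_\nu\|y-x\|^\nu$ for all $x,y\in\mathbb{R}^n$. A point $\overline{x}$ with $\psi(\overline{x})<+\infty$ is a $p$-calm point of a proper lower semicontinuous function $\psi:\mathbb{R}^n\to\mathbb{R}\cup\{+\infty\}$ if there is $M>0$ with $\psi(x)+M\|x-\overline{x}\|^p>\psi(\overline{x})$ for all $x\in\mathbb{R}^n$, $x\ne\overline{x}$. For $\psi:\mathbb{R}^n\to\mathbb{R}\cup\{+\infty\}$ and $\overline{x}$ with $\psi(\overline{x})$ finite, the Fréchet (regular) subdifferential is $\widehat{\partial}\psi(\overline{x}):=\{\zeta\in\mathbb{R}^n\mid\liminf_{x\to\overline{x}}\frac{\psi(x)-\psi(\overline{x})-\langle\zeta,x-\overline{x}\rangle}{\|x-\overline{x}\|}\ge0\}$,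 and the Mordukhovich (limiting) subdifferential $\partial\psi(\overline{x})$ is the set of $\zeta$ for which there exist $x^k\to\overline{x}$ and $\zeta^k\in\widehat{\partial}\psi(x^k)$ with $\psi(x^k)\to\psi(\overline{x})$ and $\zeta^k\to\zeta$. A proper lower semicontinuous $\psi$ is prox-regular at $\overline{x}$ (with $\psi(\overline{x})$ finite) for $\overline{\zeta}\in\partial\psi(\overline{x})$ if there exist $\varepsilon>0$ and $\rho>0$ such that $\psi(x')\ge\psi(x)+\langle\zeta,x'-x\rangle-\frac{\rho}{2}\|x'-x\|^2$ for all $x'\in\mathbf{B}(\overline{x};\varepsilon)$, whenever $x\in\mathbf{B}(\overline{x};\varepsilon)$, $\zeta\in\partial\psi(x)\cap\mathbf{B}(\overline{\zeta};\varepsilon)$, and $|\psi(x)-\psi(\overline{x})|<\varepsilon$. For $\gamma>0$, the high-order forward-backward envelope (HiFBE) of $\varphi=f+g$ is $$\varphi_\gamma^p(x):=\inf_{y\in\mathbb{R}^n}\left\{f(x)+\langle\nabla f(x),y-x\rangle+g(y)+\frac{1}{p\gamma}\|x-y\|^p\right\}.$$ *)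

(* Defs.v *)
From HB Require Import structures.
From mathcomp Require Import all_boot all_order all_algebra.
From mathcomp Require Import all_classical all_reals all_analysis.

Set Implicit Arguments.
Unset Strict Implicit.
Unset Printing Implicit Defensive.

Import Order.TTheory GRing.Theory Num.Theory.
Import numFieldNormedType.Exports.

Local Open Scope classical_set_scope.
Local Open Scope ring_scope.

(* R^n is ['rV[R]_n].  The canonical norm of ['rV[R]_n] is the sup norm, so the
   Euclidean one is defined here and is the norm used in every inequality.  The
   library's topology and differentials on ['rV[R]_n] are kept: they depend on
   the norm only up to equivalence. *)
Section Euclidean.
Context {R : realType} {n : nat}.
Implicit Types (x y : 'rV[R]_n).

Definition edot x y : R := \sum_(i < n) x ord0 i * y ord0 i.

Definition enorm x : R := Num.sqrt (edot x x).

Definition eball x (r : R) : set 'rV[R]_n := [set y | enorm (y - x) < r].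

(* Matrices act on row vectors on the right. *)
Definition opnorm (A : 'M[R]_n) : R :=
  sup [set enorm (h *m A) | h in [set h : 'rV[R]_n | enorm h <= 1]].

End Euclidean.

Section Smoothness.
Context {R : realType} {n : nat}.
Implicit Types (f : 'rV[R]_n -> R) (U : set 'rV[R]_n).

(* Only meaningful at points where [f] is differentiable. *)
Definition grad f (x : 'rV[R]_n) : 'rV[R]_n :=
  \row_(i < n) 'd f x (delta_mx ord0 i).

(* [h *m hessian f x] is the differential of [grad f] at [x] along [h]. *)
Definition hessian f (x : 'rV[R]_n) : 'M[R]_n := jacobian (grad f) x.

(* The sets [U] below are meant to be open. *)
Definition C1_on U f : Prop :=
  forall x, U x -> differentiable f x /\ {for x, continuous (grad f)}.

Definition twice_differentiable_on U f : Prop :=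
  forall x, U x -> differentiable f x /\ differentiable (grad f) x.

Definition C2_on U f : Prop :=
  twice_differentiable_on U f /\
  forall x, U x -> {for x, continuous (hessian f)}.

Definition C2_holder_on (mu L : R) U f : Prop :=
  twice_differentiable_on U f /\
  forall x y, U x -> U y ->
    opnorm (hessian f x - hessian f y) <= L * enorm (x - y) `^ mu.

Definition holder_gradient (nu L : R) f : Prop :=
  forall x y, enorm (grad f y - grad f x) <= L * enorm (y - x) `^ nu.

End Smoothness.

Section Nonsmooth.
Context {R : realType} {n : nat}.
Implicit Types (psi : 'rV[R]_n -> \bar R) (x : 'rV[R]_n).
Local Open Scope ereal_scope.

(* The first conjunct says that [psi] takes its values in R U {+oo}. *)
Definition ext_proper psi : Prop :=
  (forall x, psi x != -oo) /\ exists x, psi x \is a fin_num.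

Definition calm_point (p : R) psi (xbar : 'rV[R]_n) : Prop :=
  psi xbar < +oo /\
  exists2 M : R, (0 < M)%R &
    forall x, x != xbar -> psi xbar < psi x + (M * enorm (x - xbar) `^ p)%:E.

Definition frechet_subdiff psi (xbar : 'rV[R]_n) : set 'rV[R]_n :=
  [set zeta | psi xbar \is a fin_num /\
    0 <= limf_einf
      (fun x => (psi x - psi xbar - (edot zeta (x - xbar))%:E)
                * ((enorm (x - xbar))^-1)%:E)
      xbar^'].

Definition limiting_subdiff psi (xbar : 'rV[R]_n) : set 'rV[R]_n :=
  [set zeta | psi xbar \is a fin_num /\
    exists xs zs : nat -> 'rV[R]_n,
      [/\ xs @ \oo --> xbar,
          forall k, frechet_subdiff psi (xs k) (zs k),
          (psi \o xs) @ \oo --> psi xbar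
        & zs @ \oo --> zeta]].

Definition prox_regular psi (xbar zetabar : 'rV[R]_n) : Prop :=
  [/\ psi xbar \is a fin_num, limiting_subdiff psi xbar zetabar &
    exists eps rho : R, [/\ (0 < eps)%R, (0 < rho)%R &
      forall x zeta, eball xbar eps x ->
        limiting_subdiff psi x zeta -> eball zetabar eps zeta ->
        `|psi x - psi xbar| < eps%:E ->
        forall x', eball xbar eps x' ->
          psi x + (edot zeta (x' - x) - rho / 2 * enorm (x' - x) ^+ 2)%:E
            <= psi x']].

Definition hifbe (p gamma : R) (f : 'rV[R]_n -> R) (g : 'rV[R]_n -> \bar R)
    (x : 'rV[R]_n) : \bar R :=
  ereal_inf (range (fun y : 'rV[R]_n =>
    (f x + edot (grad f x) (y - x))%:E + g y
    + ((p * gamma)^-1 * enorm (x - y) `^ p)%:E)).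

End Nonsmooth.

(* Main.v *)
(* Let z = x - y, where y minimizes the model at x, and D z = |z|^(nu - 1) z.
   Calmness of the origin and the descent inequality force minimizers to exist
   and to satisfy |z| <= 3 |x| once gamma is small.  The optimality condition
   puts D z / gamma - grad f x in the subdifferential of g at y, so that
   prox-regularity makes these vectors hypomonotone in y.  On the unit ball D is
   strongly monotone, and for gamma small this beats the hypomonotonicity: from
   |z1 - z2|^2 <= C |x1 - x2|^nu one gets a (nu / 2)-Hoelder, hence unique,
   minimizer.  Danskin's two-sided comparison then shows that the envelope has
   gradient D z / gamma - z (hess f x)^T; as D is nu-Hoelder, the first term is
   (nu^2 / 2)-Hoelder, and the second one inherits the exponents nu / 2 of z and
   mu of the Hessian. *)

(* The exponent [p = 1 + nu] gives the descent remainder, the calmness term and the proximal term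
   the same homogeneity. Comparing a minimizer with the origin is therefore free of scale, and one
   threshold on [gamma] serves every [x].

   The obstacle is that [z] vanishes at [x = 0], which is where D fails to be differentiable when
   [nu < 1], so no implicit function argument is available. The blow-up of [|z|^(nu - 1)] helps
   monotonicity, however: inside the unit ball this factor is at least 1. Half of the exponent is
   lost because the cross terms of the monotonicity inequality are bounded by a multiple of
   [|x1 - x2|^nu] without keeping a factor [|z1 - z2|], so that a square root has to be taken.

   Prox-regularity only speaks of points where the value of [g] and the subgradient are also close
   to those at the origin, and [g] need not be continuous. Both kinds of closeness are extracted
   from minimality. The radius depends on [gamma] because the subgradients contain [D z / gamma]. *)
Require Import Defs.
From HB Require Import structures.
From mathcomp Require Import all_boot all_order all_algebra.
From mathcomp Require Import all_classical all_reals all_analysis.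
From mathcomp Require Import ring lra.
Set Implicit Arguments.
Unset Strict Implicit.
Unset Printing Implicit Defensive.
Import Order.TTheory GRing.Theory Num.Theory.
Import numFieldNormedType.Exports.
Local Open Scope classical_set_scope.
Local Open Scope ring_scope.

(* [lra] identifies atoms up to conversion, which is intractable for norms of
   matrix expressions, hence the generalizations. *)
Ltac atoms_lra :=
  repeat match goal with
  | H : ?P |- _ => lazymatch type of P with Prop => revert H end
  end;
  repeat match goal with
  | |- context [@enorm ?R ?n ?a] => generalize (@enorm R n a)
  | |- context [@edot ?R ?n ?a ?b] => generalize (@edot R n a b)
  end; intros; lra.

(** * Euclidean geometry of row vectors *)

Section EuclideanSpace.
Context {R : realType} {n : nat}.
Implicit Types (x y z : 'rV[R]_n) (a : R).

Lemma edotC x y : edot x y = edot y x.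
Proof. by apply: eq_bigr => i _; rewrite mulrC. Qed.

Lemma edotDl x y z : edot (x + y) z = edot x z + edot y z.
Proof.
by rewrite /edot -big_split; apply: eq_bigr => i _; rewrite mxE mulrDl.
Qed.

Lemma edotZl a x y : edot (a *: x) y = a * edot x y.
Proof.
by rewrite /edot big_distrr; apply: eq_bigr => i _; rewrite mxE -mulrA.
Qed.

Lemma edotDr x y z : edot z (x + y) = edot z x + edot z y.
Proof. by rewrite ![edot z _]edotC edotDl. Qed.

Lemma edotZr a x y : edot x (a *: y) = a * edot x y.
Proof. by rewrite ![edot x _]edotC edotZl. Qed.

Lemma edotNl x y : edot (- x) y = - edot x y.
Proof. by rewrite -scaleN1r edotZl mulN1r. Qed.

Lemma edotNr x y : edot x (- y) = - edot x y.
Proof. by rewrite -scaleN1r edotZr mulN1r. Qed.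

Lemma edot0l x : edot 0 x = 0.
Proof. by rewrite -(scale0r x) edotZl mul0r. Qed.

Lemma edot0r x : edot x 0 = 0.
Proof. by rewrite edotC edot0l. Qed.

Definition edotE := (edotDl, edotDr, edotNl, edotNr, edotZl, edotZr).

Lemma edot_ge0 x : 0 <= edot x x.
Proof. by apply: sumr_ge0 => i _; rewrite -expr2 sqr_ge0. Qed.

Lemma sqr_enorm x : enorm x ^+ 2 = edot x x.
Proof. by rewrite sqr_sqrtr ?edot_ge0. Qed.

Lemma enorm_ge0 x : 0 <= enorm x.
Proof. exact: sqrtr_ge0. Qed.

Lemma enorm0 : enorm (0 : 'rV[R]_n) = 0.
Proof. by rewrite /enorm edot0l sqrtr0. Qed.

Lemma enormN x : enorm (- x) = enorm x.
Proof. by rewrite /enorm !edotE opprK. Qed.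

Lemma enorm_distC x y : enorm (x - y) = enorm (y - x).
Proof. by rewrite -opprB enormN. Qed.

Lemma enormZ a x : enorm (a *: x) = `|a| * enorm x.
Proof.
by rewrite /enorm !edotE mulrA -expr2 sqrtrM ?sqr_ge0// sqrtr_sqr.
Qed.

Lemma coord_le_enorm x i : `|x ord0 i| <= enorm x.
Proof.
rewrite -sqrtr_sqr ler_wsqrtr// /edot (bigD1 i)//= expr2 lerDl.
by apply: sumr_ge0 => j _; rewrite -expr2 sqr_ge0.
Qed.

Lemma enorm_eq0 x : (enorm x == 0) = (x == 0).
Proof.
apply/eqP/eqP => [x0|->]; last exact: enorm0.
apply/rowP => i; rewrite mxE; apply/normr0_eq0/le_anti.
by rewrite normr_ge0 -x0 coord_le_enorm.
Qed.

Lemma cauchy_schwarz x y : edot x y <= enorm x * enorm y.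
Proof.
have [->|x0] := eqVneq x 0; first by rewrite edot0l enorm0 mul0r.
have nx : 0 < enorm x by rewrite lt_def enorm_ge0 enorm_eq0 x0.
have := edot_ge0 (edot x x *: y - edot x y *: x).
rewrite !edotE (edotC y x) -!sqr_enorm.
set s := enorm x in nx *; set t := enorm y; set b := edot x y => h.
have {h} : 0 <= s ^+ 2 * ((s * t) ^+ 2 - b ^+ 2) by apply: le_trans h _; lra.
rewrite pmulr_rge0 ?exprn_gt0// subr_ge0 => h.
rewrite (le_trans (ler_norm b))// -[leRHS]ger0_norm ?mulr_ge0 ?enorm_ge0//.
by rewrite -ler_sqr ?nnegrE// !real_normK ?num_real.
Qed.

Lemma norm_edot_le x y : `|edot x y| <= enorm x * enorm y.
Proof.
by rewrite ler_norml cauchy_schwarz lerNl -edotNl -[enorm x]enormN cauchy_schwarz.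
Qed.

Lemma enormD x y : enorm (x + y) <= enorm x + enorm y.
Proof.
rewrite -ler_sqr ?nnegrE ?addr_ge0 ?enorm_ge0// sqr_enorm !edotE (edotC y x).
by rewrite -!sqr_enorm; have := cauchy_schwarz x y; nra.
Qed.

Lemma enormB x y : enorm (x - y) <= enorm x + enorm y.
Proof. by rewrite -(enormN y) enormD. Qed.

Lemma lerB_enorm x y : enorm x - enorm y <= enorm (x - y).
Proof. by rewrite lerBlDr -{1}(subrK y x) enormD. Qed.

Lemma mxnorm_le_enorm x : `|x| <= enorm x.
Proof.
rewrite {1}/Num.norm /= mx_normrE; apply/bigmax_leP.
by split=> [|[i j] _]; rewrite ?enorm_ge0//= (ord1 i) coord_le_enorm.
Qed.

Lemma coord_le_mxnorm m (A : 'M[R]_(m, n)) i j : `|A i j| <= `|A|.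
Proof.
by rewrite [leRHS]/Num.norm /= mx_normrE; apply/bigmax_geP; right; exists (i, j).
Qed.

End EuclideanSpace.

Section EuclideanTopology.
Context {R : realType} {n : nat}.
Implicit Types (x y z : 'rV[R]_n) (a : R).

Lemma enorm_sum (I : Type) (r : seq I) (P : pred I) (F : I -> 'rV[R]_n) :
  enorm (\sum_(i <- r | P i) F i) <= \sum_(i <- r | P i) enorm (F i).
Proof.
elim/big_ind2 : _ => [|x1 x2 y1 y2 h1 h2|//]; first by rewrite enorm0.
by apply: le_trans (enormD _ _) _; exact: lerD.
Qed.

Lemma enorm_delta (i : 'I_n) : enorm (delta_mx ord0 i : 'rV[R]_n) = 1.
Proof.
rewrite /enorm /edot (bigD1 i)//= mxE !eqxx mulr1 big1 ?addr0 ?sqrtr1//.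
by move=> j ji; rewrite mxE (negPf ji) andbF mulr0.
Qed.

Lemma enorm_le_mxnorm x : enorm x <= n%:R * `|x|.
Proof.
rewrite {1}(row_sum_delta x); apply: le_trans (enorm_sum _ _ _) _.
rewrite mulr_natl -[X in _ *+ X]card_ord -sumr_const; apply: ler_sum => i _.
by rewrite enormZ enorm_delta mulr1 coord_le_mxnorm.
Qed.

(** The library's neighbourhoods come from the sup norm; this bridge rests on the equivalence of the
    two norms with constants 1 and [n]. *)
Lemma nbhs_eball x (P : set 'rV[R]_n) :
  nbhs x P <-> exists2 r : R, 0 < r & eball x r `<=` P.
Proof.
split.
- move=> /nbhs_ballP[e e0 eP]; exists e => // y; rewrite /eball/= => xy.
  apply: eP; rewrite -ball_normE/= distrC; apply: le_lt_trans xy.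
  exact: mxnorm_le_enorm.
(* Dividing by [n.+1] instead of [n] keeps the radius positive in dimension 0. *)
- move=> [r r0 rP]; apply/nbhs_ballP; exists (r / n.+1%:R) => /=.
    by rewrite divr_gt0.
  move=> y; rewrite -ball_normE/= distrC ltr_pdivlMr// => xy.
  apply: rP; rewrite /eball/=; apply: le_lt_trans (enorm_le_mxnorm _) _.
  apply: le_lt_trans xy; rewrite mulrC ler_wpM2l//.
  by rewrite ler_nat.
Qed.

Lemma enorm_lt_near e : 0 < e -> \forall h \near (0 : 'rV[R]_n), enorm h < e.
Proof.
move=> e0; apply/nbhs_eball; exists e => // h; rewrite /eball/= subr0; exact.
Qed.

Lemma cvg_enormP (T : Type) (F : set_system T) {FF : Filter F}
    (u : T -> 'rV[R]_n) x :
  u @ F --> x <-> forall e, 0 < e -> \forall t \near F, enorm (u t - x) < e.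
Proof.
split.
- move=> ux e e0; suff /ux : nbhs x [set y | enorm (y - x) < e] by [].
  by rewrite nbhs_eball; exists e.
- move=> h P; rewrite nbhs_eball => -[r r0 rP].
  by apply: (@filterS _ F _ [set t | enorm (u t - x) < r]) (h r r0) => t; apply: rP.
Qed.

(** Registered as a linear structure so that [edot G] can be a candidate differential in
    [grad_unique]. *)
Lemma edot_is_linear z : linear (edot z : 'rV[R]_n -> R).
Proof. by move=> a x y; rewrite !edotE. Qed.

HB.instance Definition _ z :=
  GRing.isLinear.Build R 'rV[R]_n R *:%R (edot z) (edot_is_linear z).

Lemma edot_continuous z : continuous (edot z : 'rV[R]_n -> R).
Proof.
move=> x; apply/(@cvgrPdist_lt _ _ _ (nbhs x)) => e e0.
have := @enorm_lt_near (e / (enorm z + 1)); rewrite divr_gt0 ?ltr_wpDl ?enorm_ge0//.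
move=> /(_ isT) /nbhs_eball[r r0 h]; apply/(nbhs_eball x); exists r => // y xy.
have /= := h (y - x); rewrite /eball/= subr0 => /(_ xy).
rewrite ltr_pdivlMr ?ltr_wpDl ?enorm_ge0// => {}h.
rewrite distrC -edotNr -edotDr; apply: le_lt_trans (norm_edot_le _ _) _.
by apply: le_lt_trans h; rewrite mulrC ler_wpM2l ?enorm_ge0// lerDl.
Qed.

End EuclideanTopology.

(** * Powers of the norm *)

Section PowerFunction.
Context {R : realType}.
Implicit Types (nu s t u : R).

Lemma powR_bernoulli nu u : 0 <= nu <= 1 -> 0 <= u ->
  u `^ nu <= 1 + nu * (u - 1).
Proof.
move=> /andP[nu0 nu1]; rewrite le_eqVlt => /predU1P[<-|u0].
  have [->|nun0] := eqVneq nu 0; first by rewrite powRr0 mul0r addr0.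
  by rewrite powR0// add0r mulrN1 subr_ge0.
(* Tangent line of [expR] at [nu * ln u], evaluated at [ln u] and at [0] *)
rewrite {1}/powR gt_eqF//; set x := ln u.
have hu : u = expR (nu * x) * expR ((1 - nu) * x).
  by rewrite -expRD -mulrDl addrC subrK mul1r lnK.
have h1 : 1 = expR (nu * x) * expR (- (nu * x)) by rewrite -expRD subrr expR0.
have e0 := expR_ge0 (nu * x).
have : expR (nu * x) * (nu * (1 + (1 - nu) * x) + (1 - nu) * (1 + - (nu * x)))
    <= expR (nu * x) * (nu * expR ((1 - nu) * x) + (1 - nu) * expR (- (nu * x))).
  by rewrite ler_wpM2l// lerD// ler_wpM2l ?subr_ge0// expR_ge1Dx.
rewrite [leRHS]mulrDr [X in _ <= X + _]mulrCA [X in _ <= _ + X]mulrCA -hu -h1 => h.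
by apply: le_trans (le_trans h _); lra.
Qed.

(** On [[0, 1]] the slope [nu * u ^ (nu - 1)] is at least [nu]. Scaling the Bernoulli inequality at
    [t / s] avoids derivatives and includes [t = 0]. *)
Lemma powR_diff_ge nu s t : 0 < nu <= 1 -> 0 <= t -> t <= s -> s <= 1 ->
  nu * (s - t) <= s `^ nu - t `^ nu.
Proof.
move=> /andP[nu0 nu1] t0 ts s1.
have [s0|s0] := eqVneq s 0.
  have -> : t = 0 by apply/le_anti; rewrite t0 -s0 ts.
  by rewrite s0 !subrr mulr0.
have {}s0 : 0 < s by rewrite lt_def s0 (le_trans t0).
have -> : t `^ nu = s `^ nu * (t / s) `^ nu.
  by rewrite -powRM ?divr_ge0 ?(ltW s0)// mulrCA divff ?mulr1// gt_eqF.
have := powR_bernoulli (nu := nu) (u := t / s); rewrite (ltW nu0) nu1 divr_ge0 ?(ltW s0)//.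
move=> /(_ isT isT) h.
have hs : 1 <= s `^ nu / s.
  rewrite ler_pdivlMr// mul1r ger1_powR// s0 s1//.
apply: (@le_trans _ _ (s `^ nu / s * (nu * (s - t)))).
  by rewrite ler_peMl// mulr_ge0 ?subr_ge0// ltW.
have -> : s `^ nu / s * (nu * (s - t)) = s `^ nu * - (nu * (t / s - 1)).
  by field; rewrite gt_eqF.
rewrite -[X in _ <= X - _]mulr1 -mulrBr ler_wpM2l ?powR_ge0//; lra.
Qed.

Lemma powR_young nu s t : 0 < nu -> 0 <= s -> 0 <= t ->
  s `^ nu * t <= t `^ (1 + nu) / (1 + nu) + nu / (1 + nu) * s `^ (1 + nu).
Proof.
move=> nu0 s0 t0; have p0 : 0 < 1 + nu by rewrite addr_gt0.
have q1 : (1 + nu)^-1 + ((1 + nu) / nu)^-1 = 1 by field; rewrite !gt_eqF.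
have := @conjugate_powR _ t (s `^ nu) (1 + nu) ((1 + nu) / nu) t0 (powR_ge0 _ _) p0.
rewrite divr_gt0// => /(_ isT q1).
by rewrite -powRrM mulrCA divff ?gt_eqF// mulr1 invf_div (mulrC t) (mulrC (nu / _)).
Qed.

Lemma powR_lt_near0 nu c e : 0 < nu -> 0 < c -> 0 < e ->
  exists2 d : R, 0 < d & forall t, 0 <= t -> t < d -> c * t `^ nu < e.
Proof.
move=> nu0 c0 e0; exists ((e / c) `^ nu^-1); first exact/powR_gt0/divr_gt0.
move=> t t0 td; rewrite mulrC -ltr_pdivlMr//.
have -> : e / c = (e / c) `^ nu^-1 `^ nu.
  by rewrite -powRrM mulVf ?gt_eqF// powRr1// ltW// divr_gt0.
by rewrite gt0_ltr_powR// nnegrE ?powR_ge0.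
Qed.

End PowerFunction.

Section NormPower.
Context {R : realType} {n : nat}.
Implicit Types (nu : R) (a b h : 'rV[R]_n).

(* The gradient at [a] of [enorm ^ (1 + nu) / (1 + nu)]; it is [0] at [0]
   whatever the value of [0 `^ (nu - 1)]. *)
Definition normpow_grad nu a := enorm a `^ (nu - 1) *: a.

Lemma enorm_normpow_grad nu a : 0 < nu ->
  enorm (normpow_grad nu a) = enorm a `^ nu.
Proof.
by move=> nu0; rewrite enormZ ger0_norm ?powR_ge0// mulrC mulr_powRB1 ?enorm_ge0.
Qed.

Lemma edot_normpow_grad nu a : 0 < nu ->
  edot (normpow_grad nu a) a = enorm a `^ (1 + nu).
Proof.
move=> nu0; rewrite edotZl -sqr_enorm expr2 mulrCA [_ * enorm a]mulrC.
rewrite mulr_powRB1 ?enorm_ge0// -[1 + nu in RHS]addrC.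
rewrite -[in RHS](@mulr_powRB1 _ _ (nu + 1)) ?addr_gt0 ?enorm_ge0//.
by rewrite addrK.
Qed.

(** Convexity of the power of the norm, without differentiation: as [normpow_grad nu a] has norm
    [|a|^nu] and pairs with [a] to [|a|^(1 + nu)], Cauchy-Schwarz reduces the claim to the scalar
    Young inequality. *)
Lemma normpow_subgrad nu a b : 0 < nu ->
  enorm a `^ (1 + nu) / (1 + nu) + edot (normpow_grad nu a) (b - a)
  <= enorm b `^ (1 + nu) / (1 + nu).
Proof.
move=> nu0; have p0 : 0 < 1 + nu by rewrite addr_gt0.
rewrite edotDr edotNr edot_normpow_grad//.
have := cauchy_schwarz (normpow_grad nu a) b; rewrite enorm_normpow_grad// => h1.
have := powR_young nu0 (enorm_ge0 a) (enorm_ge0 b).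
rewrite [nu / _](_ : _ = 1 - (1 + nu)^-1); last by field; rewrite gt_eqF.
by atoms_lra.
Qed.

(** Write [s], [t] for the norms, [al], [be] for their powers [nu - 1], and [q] for [edot a b]. The
    difference of the two sides is a radial part [(al s - be t)(s - t) - nu (s - t)^2], nonnegative
    by [powR_diff_ge], plus an angular part [(al + be - 2 nu)(s t - q)]. *)
Lemma normpow_grad_monotone nu a b : 0 < nu <= 1 ->
  enorm a <= 1 -> enorm b <= 1 ->
  nu * enorm (a - b) ^+ 2 <=
  edot (normpow_grad nu a - normpow_grad nu b) (a - b).
Proof.
move=> nu01 a1 b1; have /andP[nu0 nu1] := nu01.
wlog ba : a b a1 b1 / enorm b <= enorm a.
  move=> H; have /orP[ba|ab] := le_total (enorm b) (enorm a); first exact: H.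
  rewrite enorm_distC; apply: le_trans (H b a _ _ _) _ => //.
  by rewrite !edotE; atoms_lra.
have hge := powR_diff_ge nu01 (enorm_ge0 b) ba a1.
have hcs := cauchy_schwarz a b.
have e1 (x : 'rV[R]_n) : x != 0 -> enorm x <= 1 -> 1 <= enorm x `^ (nu - 1).
  move=> x0 x1; rewrite -[leLHS](@powRr0 _ (enorm x)) ger_powR ?subr_le0//.
  by rewrite lt_def enorm_eq0 x0 enorm_ge0.
have hab : 0 <= (enorm a `^ (nu - 1) + enorm b `^ (nu - 1) - 2 * nu)
     * (enorm a * enorm b - edot a b).
  have [->|a0] := eqVneq a 0; first by rewrite edot0l enorm0 mul0r subrr mulr0.
  have [->|b0] := eqVneq b 0; first by rewrite edot0r enorm0 mulr0 subrr mulr0.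
  rewrite mulr_ge0 ?subr_ge0//.
  by have := e1 _ a0 a1; have := e1 _ b0 b1; atoms_lra.
have {}hge := ler_wpM2r (_ : 0 <= enorm a - enorm b) hge.
rewrite subr_ge0 in hge; have {hge} := hge ba.
rewrite -(mulr_powRB1 (enorm_ge0 a) nu0) -(mulr_powRB1 (enorm_ge0 b) nu0).
rewrite sqr_enorm /normpow_grad !edotE (edotC b a) -!sqr_enorm.
move: hab.
set s := enorm a; set t := enorm b; set al := _ `^ _; set be := _ `^ _.
by set q := edot a b; atoms_lra.
Qed.

(** With [|b| <= |a| = s] and [d = |a - b|], the difference is split into a change of vector at
    fixed weight and a change of weight on [b]. Each is at most [s^(nu - 1) d <= 2 d^nu], whence the
    4. *)
Lemma normpow_grad_holder nu a b : 0 < nu <= 1 ->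
  enorm (normpow_grad nu a - normpow_grad nu b) <= 4 * enorm (a - b) `^ nu.
Proof.
move=> /andP[nu0 nu1].
wlog ba : a b / enorm b <= enorm a.
  move=> H; have /orP[ba|ab] := le_total (enorm b) (enorm a); first exact: H.
  by rewrite (enorm_distC a b) -opprB enormN; exact: H.
have [->|ab0] := eqVneq a b.
  by rewrite subrr enorm0 mulr_ge0 ?powR_ge0.
have [a0|a0] := eqVneq a 0.
  move: ba ab0; rewrite a0 enorm0 => ba; rewrite eq_sym -enorm_eq0.
  by rewrite eq_le ba enorm_ge0.
set s := enorm a; set t := enorm b; set d := enorm (a - b).
have s0 : 0 < s by rewrite lt_def enorm_eq0 a0 enorm_ge0.
have d0 : 0 < d by rewrite lt_def enorm_eq0 subr_eq0 ab0 enorm_ge0.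
have ds : d <= 2 * s by have := enormB a b; rewrite -/d -/s -/t; move: ba; rewrite -/s -/t; atoms_lra.
(* [s >= d / 2], hence [s ^ (nu - 1) * d <= 2 * d ^ nu] *)
have key : s `^ (nu - 1) * d <= 2 * d `^ nu.
  rewrite -(mulr_powRB1 (ltW d0) nu0) [d * _]mulrC mulrA.
  rewrite ler_wpM2r ?(ltW d0)// -[nu - 1]opprB !powRN.
  rewrite -ler_pdivrMl// -invfM lef_pV2 ?posrE ?mulr_gt0 ?powR_gt0//.
  apply: (@le_trans _ _ ((2 * s) `^ (1 - nu))).
    by rewrite ge0_ler_powR ?subr_ge0// nnegrE ?mulr_ge0 ?ltW.
  rewrite powRM ?(ltW s0)// ler_wpM2r ?powR_ge0//.
  by rewrite -[leRHS]powRr1// ler_powR ?ler1n// gerBl ltW.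
have -> : normpow_grad nu a - normpow_grad nu b =
    s `^ (nu - 1) *: (a - b) + (s `^ (nu - 1) - t `^ (nu - 1)) *: b.
  by rewrite /normpow_grad scalerBr scalerBl addrA subrK.
apply: le_trans (enormD _ _) _.
rewrite 2!enormZ ger0_norm ?powR_ge0// -/d -/t.
(* The left side equals [t^nu - s^(nu - 1) t], which is at most
   [s^nu - s^(nu - 1) t = s^(nu - 1) (s - t)]. *)
suff : `|s `^ (nu - 1) - t `^ (nu - 1)| * t <= s `^ (nu - 1) * d by move: key; atoms_lra.
have [t0|t0] := eqVneq t 0; first by rewrite t0 mulr0 mulr_ge0 ?powR_ge0 ?ltW.
have {}t0 : 0 < t by rewrite lt_def t0 enorm_ge0.
rewrite ler0_norm; last first.
  rewrite subr_le0 -[nu - 1]opprB !powRN lef_pV2 ?posrE ?powR_gt0//.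
  by rewrite ge0_ler_powR ?subr_ge0// nnegrE ltW.
have ht := mulr_powRB1 (ltW t0) nu0; have hs := mulr_powRB1 (ltW s0) nu0.
have hts : t `^ nu <= s `^ nu by rewrite ge0_ler_powR ?nnegrE ?(ltW s0) ?(ltW t0) ?(ltW nu0).
have : 0 <= s `^ (nu - 1) * (d - (s - t)).
  by rewrite mulr_ge0 ?powR_ge0// subr_ge0 lerB_enorm.
by move: ht hs hts; clear -s t d; clearbody s t d; lra.
Qed.

(** The subgradient inequality is read at [a + h] towards [a], and the gradient there is exchanged
    for the one at [a] by Hoelder continuity. With [normpow_subgrad] this gives a two-sided
    expansion with remainder of order [1 + nu]. *)
Lemma normpow_expansion nu a h : 0 < nu <= 1 ->
  enorm (a + h) `^ (1 + nu) / (1 + nu)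
  <= enorm a `^ (1 + nu) / (1 + nu) + edot (normpow_grad nu a) h
     + 4 * enorm h `^ (1 + nu).
Proof.
move=> nu01; have /andP[nu0 _] := nu01.
have := normpow_subgrad (a + h) a nu0.
rewrite opprD addNKr edotNr => h1.
have := cauchy_schwarz (normpow_grad nu (a + h) - normpow_grad nu a) h.
have := normpow_grad_holder (a + h) a nu01.
rewrite addrAC subrr add0r => /(ler_wpM2r (enorm_ge0 h)).
rewrite edotDl edotNl -mulrA [_ `^ _ * enorm h]mulrC.
have := @mulr_powRB1 _ (enorm h) (1 + nu) (enorm_ge0 h).
rewrite addrAC subrr add0r addr_gt0// => /(_ isT) ->.
by atoms_lra.
Qed.

End NormPower.

(** * Operator norm, gradient and descent inequality *)

Section OperatorNorm.
Context {R : realType} {n : nat}.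
Implicit Types (x y h : 'rV[R]_n) (A B : 'M[R]_n).

Lemma enorm_mulmx_le A h : enorm (h *m A) <= n%:R * (n%:R * `|A|) * enorm h.
Proof.
apply: le_trans (enorm_le_mxnorm _) _; rewrite -[leRHS]mulrA ler_wpM2l ?ler0n//.
rewrite [leLHS]/Num.norm /= mx_normrE; apply/bigmax_leP.
split=> [|[i j] _ /=]; first by rewrite !mulr_ge0 ?ler0n ?enorm_ge0.
rewrite (ord1 i) mxE; apply: le_trans (ler_norm_sum _ _ _) _.
rewrite -mulrA mulr_natl -[X in _ *+ X]card_ord -sumr_const; apply: ler_sum => k _.
by rewrite normrM mulrC ler_pM ?coord_le_enorm ?coord_le_mxnorm.
Qed.

Lemma opnorm_has_sup A :
  has_sup [set enorm (h *m A) | h in [set h : 'rV[R]_n | enorm h <= 1]].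
Proof.
split; first by exists (enorm (0 *m A)), 0 => //=; rewrite enorm0.
exists (n%:R * (n%:R * `|A|)) => _ [h /= h1 <-].
apply: le_trans (enorm_mulmx_le _ _) _.
by rewrite ler_piMr// !mulr_ge0 ?ler0n.
Qed.

Lemma opnorm_ge0 A : 0 <= opnorm A.
Proof.
have /ubP h := sup_upper_bound (opnorm_has_sup A).
by apply: h; exists 0; rewrite /= ?mul0mx enorm0.
Qed.

Lemma opnorm_le_mxnorm A : opnorm A <= n%:R * (n%:R * `|A|).
Proof.
apply: ge_sup; first by case: (opnorm_has_sup A).
move=> _ [h /= h1 <-]; apply: le_trans (enorm_mulmx_le _ _) _.
by rewrite ler_piMr// !mulr_ge0 ?ler0n.
Qed.

Lemma enorm_mulmx A h : enorm (h *m A) <= opnorm A * enorm h.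
Proof.
have [->|h0] := eqVneq h 0; first by rewrite mul0mx enorm0 mulr0.
have nh : 0 < enorm h by rewrite lt_def enorm_eq0 h0 enorm_ge0.
rewrite -ler_pdivrMr//.
have /ubP H := sup_upper_bound (opnorm_has_sup A).
have -> : enorm (h *m A) / enorm h = enorm (((enorm h)^-1 *: h) *m A).
  by rewrite -scalemxAl enormZ ger0_norm ?invr_ge0 ?enorm_ge0// mulrC.
apply: H; exists ((enorm h)^-1 *: h) => //=.
by rewrite enormZ ger0_norm ?invr_ge0 ?enorm_ge0// mulVf// gt_eqF.
Qed.

Lemma edot_mulmx A x y : edot (x *m A) y = edot x (y *m A^T).
Proof.
rewrite /edot; under eq_bigr do rewrite mxE big_distrl.
rewrite exchange_big; apply: eq_bigr => i _; rewrite mxE big_distrr /=.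
by apply: eq_bigr => j _; rewrite mxE -mulrA [A i j * _]mulrC.
Qed.

(** By duality: the square of the left side is the pairing of [h *m A^T *m A] with [h]. *)
Lemma enorm_mulmx_tr A h : enorm (h *m A^T) <= opnorm A * enorm h.
Proof.
have [/eqP ->|n0] := boolP (enorm (h *m A^T) == 0).
  by rewrite mulr_ge0 ?opnorm_ge0 ?enorm_ge0.
have {}n0 : 0 < enorm (h *m A^T) by rewrite lt_def n0 enorm_ge0.
rewrite -(ler_pM2l n0) -expr2 sqr_enorm -edot_mulmx.
apply: le_trans (cauchy_schwarz _ _) _.
by rewrite mulrA ler_wpM2r ?enorm_ge0// mulrC enorm_mulmx.
Qed.

Lemma opnorm_continuous_at (H : 'rV[R]_n -> 'M[R]_n) x (e : R) :
  {for x, continuous H} -> 0 < e ->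
  exists2 r : R, 0 < r & forall y, enorm (y - x) < r -> opnorm (H y - H x) < e.
Proof.
move=> Hx e0; pose c : R := n%:R * n%:R + 1.
have c0 : 0 < c by rewrite ltr_wpDl// mulr_ge0 ?ler0n.
have /(@cvgrPdist_lt _ _ _ (nbhs x)) /(_ (e / c)) := Hx.
rewrite divr_gt0// => /(_ isT) /(nbhs_eball x) [r r0 rP].
exists r => // y /rP /=; rewrite distrC ltr_pdivlMr// => h.
apply: le_lt_trans (opnorm_le_mxnorm _) _; apply: le_lt_trans h.
by rewrite mulrA mulrC ler_wpM2l ?normr_ge0// lerDl.
Qed.

End OperatorNorm.

Section Gradient.
Context {R : realType} {n : nat}.
Implicit Types (f : 'rV[R]_n -> R) (x y h : 'rV[R]_n).

Lemma diff_grad f x h : 'd f x h = edot (grad f x) h.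
Proof.
rewrite {1}(row_sum_delta h) linear_sum; apply: eq_bigr => i _.
by rewrite linearZ /= mxE mulrC.
Qed.

Lemma diff_remainder (W : normedModType R) (f : 'rV[R]_n -> W) x (e : R) :
  differentiable f x -> 0 < e ->
  exists2 r : R, 0 < r & forall h, enorm h < r ->
    `|f (x + h) - f x - 'd f x h| <= e * enorm h.
Proof.
move=> /diff_locally fx e0.
have /eqaddoP /(_ e e0) /(nbhs_eball (0 : 'rV[R]_n)) [r r0 rP] := fx.
exists r => // h hr; have /rP /= : eball 0 r h by rewrite /eball/= subr0.
rewrite !fctE /= opprD addrA (addrC h) => /le_trans; apply.
by rewrite ler_wpM2l ?(ltW e0) ?mxnorm_le_enorm.
Qed.

Lemma grad_remainder f x (e : R) : differentiable (grad f) x -> 0 < e ->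
  exists2 r : R, 0 < r & forall h, enorm h < r ->
    enorm (grad f (x + h) - grad f x - h *m hessian f x) <= e * enorm h.
Proof.
move=> fx e0; have c0 : 0 < (n%:R + 1 : R) by rewrite ltr_wpDl.
have [|r r0 rP] := @diff_remainder _ _ _ (e / (n%:R + 1)) fx.
  by rewrite divr_gt0.
exists r => // h /rP; rewrite mul_rV_lin1.
rewrite mulrAC ler_pdivlMr// => H; apply: le_trans (enorm_le_mxnorm _) _.
by apply: le_trans H; rewrite mulrC ler_wpM2l// lerDl.
Qed.

(** A first-order expansion yields differentiability as well as the gradient; the envelope is not
    known to be differentiable beforehand. *)
Lemma grad_unique f x (G : 'rV[R]_n) :
  (forall e : R, 0 < e -> exists2 r : R, 0 < r & forall h, enorm h < r ->
     `|f (x + h) - f x - edot G h| <= e * enorm h) ->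
  differentiable f x /\ grad f x = G.
Proof.
move=> H.
have H' : f \o shift x = cst (f x) + edot G +o_ (0 : 'rV[R]_n) id.
  apply/eqaddoP => e e0; pose c : R := n%:R + 1.
  have c0 : 0 < c by rewrite ltr_wpDl.
  have [|r r0 rP] := H (e / c); first by rewrite divr_gt0.
  apply/(nbhs_eball (0 : 'rV[R]_n)); exists r => // h.
  rewrite /eball/= subr0 => /rP; rewrite !fctE /= opprD addrA (addrC h).
  move=> /le_trans; apply; rewrite mulrAC ler_pdivrMr// -mulrA ler_wpM2l ?(ltW e0)//.
  by apply: le_trans (enorm_le_mxnorm _) _; rewrite mulrC ler_wpM2l// lerDl.
have dG : 'd f x = edot G :> (_ -> _).
  exact: (diff_unique (@edot_continuous _ _ G) H').
split.
- by apply/diff_locallyP; rewrite dG; split => //; exact: edot_continuous.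
- apply/rowP => i; rewrite mxE dG /edot (bigD1 i)//= mxE !eqxx mulr1.
  by rewrite big1 ?addr0// => j ji; rewrite mxE (negPf ji) andbF mulr0.
Qed.

(** Mean value theorem along the segment. Integration would give [L / (1 + nu)]; the coarser
    constant suffices. *)
Lemma descent f (nu L : R) x y : 0 <= nu -> 0 <= L ->
  (forall z, differentiable f z) -> holder_gradient nu L f ->
  `|f y - f x - edot (grad f x) (y - x)| <= L * enorm (y - x) `^ (1 + nu).
Proof.
move=> nu0 L0 df hf; pose l (t : R) := f (x + t *: (y - x)).
have dl (t : R) : is_derive t (1 : R) l (edot (grad f (x + t *: (y - x))) (y - x)).
  have E : (fun h : R => h^-1 *: ((l \o shift t) (h *: (1 : R)) - l t)) =
      fun h : R => h^-1 *: ((f \o shift (x + t *: (y - x))) (h *: (y - x))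
                        - f (x + t *: (y - x))).
    apply/funext => h /=; congr (_ *: (f _ - _)).
    by rewrite [h *: _]mulr1 scalerDl addrCA.
  apply: DeriveDef; first by rewrite /derivable E; exact/diff_derivable/df.
  by rewrite /derive E -diff_grad -deriveE.
have [|c] := MVT ltr01 (fun (t : R) (_ : t \in `]0, 1[) => dl t).
  apply: continuous_subspaceT => t; apply: differentiable_continuous.
  by apply/derivable1_diffP; case: (dl t).
rewrite in_itv /= => /andP[c0 c1].
rewrite /l scale1r scale0r addr0 [x + (y - x)]addrC subrK subr0 mulr1 => ->.
rewrite -edotNl -edotDl; apply: le_trans (norm_edot_le _ _) _.
apply: le_trans (ler_wpM2r (enorm_ge0 _) (hf _ _)) _.
rewrite -mulrA ler_wpM2l// addrAC subrr add0r.
rewrite -(@mulr_powRB1 _ _ (1 + nu)) ?enorm_ge0 ?ltr_pwDl// [1 + nu]addrC addrK mulrC.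
rewrite ler_wpM2l ?enorm_ge0// ge0_ler_powR ?nnegrE ?enorm_ge0//.
by rewrite enormZ ler_piMl ?enorm_ge0// ger0_norm ltW.
Qed.

End Gradient.

(** * Minimizers of the forward-backward model *)

Section LowerSemicontinuous.
Context {R : realType} {n : nat}.
Implicit Types (psi : 'rV[R]_n -> \bar R) (x y : 'rV[R]_n).
Local Open Scope ereal_scope.

Lemma lte_fin_dense (a : R) (x : \bar R) : a%:E < x -> exists2 b : R, (a < b)%R & b%:E < x.
Proof.
case: x => [r| |] //; last by exists (a + 1)%R; rewrite ?ltrDl ?ltry.
rewrite lte_fin => ar; exists ((a + r) / 2)%R; first by rewrite midf_lt.
by rewrite lte_fin midf_lt.
Qed.

(** The hypothesis on [s] is a pointwise linear minorant, which a convex function such as the model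
    supplies through a subgradient. *)
Lemma lower_semicontinuous_add (s : 'rV[R]_n -> R) psi :
  (forall y, exists C : R, forall w, s y - C * enorm (w - y) <= s w)%R ->
  lower_semicontinuous psi -> lower_semicontinuous (fun y => (s y)%:E + psi y).
Proof.
move=> hs hpsi y a ay.
have : (a - s y)%:E < psi y by rewrite EFinB lteBlDr// addeC.
(* The gap [b - (a - s y)] is the amount by which [s] may drop near [y]. *)
move=> /lte_fin_dense[b ab] /hpsi[V yV bV]; have [C sC] := hs y.
pose c : R := (`|C| + 1)%R.
have c0 : (0 < c)%R by rewrite ltr_wpDl.
exists (V `&` eball y ((b - (a - s y)) / c)%R).
  apply: filterI => //; apply/nbhs_eball; eexists; last exact: subset_refl.
  by rewrite divr_gt0// subr_gt0.
move=> w [/bV bw]; rewrite /eball/= ltr_pdivlMr// => wy.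
apply: (@le_lt_trans _ _ ((s w)%:E + b%:E)); last by rewrite lteD2lE.
rewrite -EFinD lee_fin; apply: le_trans (lerD (sC w) (lexx b)).
have : (C * enorm (w - y) <= enorm (w - y) * c)%R.
  rewrite mulrC ler_wpM2l ?enorm_ge0// (le_trans (ler_norm C))// lerDl.
  exact: ler01.
by lra.
Qed.

Lemma eball_closed_compact (K : R) : compact [set y : 'rV[R]_n | enorm y <= K]%R.
Proof.
apply: bounded_closed_compact.
  exists K; split; first exact: num_real.
  move=> k Kk y /= yK; apply: le_trans (mxnorm_le_enorm _) _.
  exact: le_trans yK (ltW Kk).
rewrite -[X in closed X]setCK; apply: open_closedC.
rewrite openE => y /= /negP; rewrite -ltNge => Ky.
apply/nbhs_eball; exists (enorm y - K)%R; first by rewrite subr_gt0.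
move=> z; rewrite /eball/= => zy; apply/negP; rewrite -ltNge.
by have := lerB_enorm y z; rewrite enorm_distC; lra.
Qed.

(** The direct method. Coercivity is only available below the level of [y0], so the minimizing
    sequence is also kept below [psi y0]; the case where [y0] is itself a minimizer is settled
    apart. *)
Lemma lower_semicontinuous_argmin psi y0 (b K : R) :
  lower_semicontinuous psi -> psi y0 \is a fin_num ->
  (forall y, b%:E <= psi y) -> (forall y, psi y <= psi y0 -> (enorm y <= K)%R) ->
  exists y, forall w, psi y <= psi w.
Proof.
move=> lsc fin0 lb coer; set m := ereal_inf (range psi).
have mle w : m <= psi w by apply: ereal_inf_lbound; exists w.
have mfin : m \is a fin_num.
  rewrite fin_numElt; apply/andP; split.
    apply: (@lt_le_trans _ _ b%:E); first exact: ltNyr.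
    by apply: le_ereal_inf_tmp => _ [w _ <-].
  by apply: le_lt_trans (mle y0) _; rewrite ltey_eq fin0.
have [h|h] := leP (psi y0) m; first by exists y0 => w; exact: le_trans h (mle w).
have /choice[u hu] (k : nat) : exists y, psi y < mine (psi y0) (m + (k.+1%:R^-1)%:E).
  have /ereal_inf_lt[_ [y _ <-] hy] : m < mine (psi y0) (m + (k.+1%:R^-1)%:E).
    by rewrite lt_min h lteDl//= lte_fin invr_gt0 ltr0n.
  by exists y.
have := @eball_closed_compact K; move=> /(_ (u @ \oo) _) [].
  by exists 0%N => // k _ /=; apply: coer; apply/ltW; have := hu k; rewrite lt_min => /andP[].
move=> y [_ ycl]; exists y => w; apply: le_trans (mle w).
rewrite leNgt; apply/negP => my.
have [a ma] : exists2 a, (fine m < a)%R & a%:E < psi y.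
  by apply: lte_fin_dense; rewrite fineK.
move=> /lsc[V yV aV].
have am0 : (0 < a - fine m)%R by rewrite subr_gt0.
(* A late term of the sequence lies in [V], so its value exceeds [a], although it is at most
   [m + 1 / (k + 1) <= a]. *)
have [z [zu zV]] : (u @` [set k | (k.+1%:R^-1 < a - fine m :> R)%R]) `&` V !=set0.
  apply: ycl => //; apply: filterS (near_infty_natSinv_lt (PosNum am0)) => k hk.
  by exists k.
case: zu zV => k /= hk <- /aV; apply/negP; rewrite -leNgt.
have := hu k; rewrite lt_min => /andP[_ /ltW/le_trans]; apply.
by rewrite -(fineK mfin) -EFinD lee_fin -lerBrDl ltW.
Qed.

End LowerSemicontinuous.

Section ProximalModel.
Context {R : realType} {n : nat}.
Context (nu gamma : R) (f : 'rV[R]_n -> R) (g : 'rV[R]_n -> \bar R).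
Implicit Types (x y w h : 'rV[R]_n).

Definition hifbe_model x y : R :=
  f x + edot (grad f x) (y - x) + ((1 + nu) * gamma)^-1 * enorm (x - y) `^ (1 + nu).

Definition hifbe_argmin x y : Prop :=
  g y \is a fin_num /\
  forall w, ((hifbe_model x y)%:E + g y <= (hifbe_model x w)%:E + g w)%E.

Lemma hifbe_modelE x :
  hifbe (1 + nu) gamma f g x
  = ereal_inf (range (fun y => (hifbe_model x y)%:E + g y)%E).
Proof.
by rewrite /hifbe; under [in LHS]eq_fun do rewrite addeAC -EFinD.
Qed.

Lemma hifbe_argminE x y : hifbe_argmin x y ->
  hifbe (1 + nu) gamma f g x = (hifbe_model x y + fine (g y))%:E.
Proof.
move=> [gy ymin]; rewrite hifbe_modelE EFinD fineK//; apply/eqP; rewrite eq_le.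
apply/andP; split; first by apply: ereal_inf_lbound; exists y.
by apply: le_ereal_inf_tmp => _ [w _ <-].
Qed.

Lemma hifbe_model_lsc x y : 0 < nu -> 0 < gamma -> exists C : R, forall w,
  hifbe_model x y - C * enorm (w - y) <= hifbe_model x w.
Proof.
move=> nu0 gamma0; pose D := normpow_grad nu (x - y).
exists (enorm (grad f x) + gamma^-1 * enorm D) => w.
have := normpow_subgrad (x - y) (x - w) nu0.
have -> : x - w - (x - y) = y - w by rewrite addrC opprB subrKA.
rewrite -/D => h1.
have h2 : - edot D (y - w) <= enorm D * enorm (w - y).
  by rewrite -edotNr opprB cauchy_schwarz.
have h3 : - edot (grad f x) (w - y) <= enorm (grad f x) * enorm (w - y).
  by rewrite -edotNr enorm_distC opprB cauchy_schwarz.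
have : gamma^-1 * (enorm (x - y) `^ (1 + nu) / (1 + nu) - enorm D * enorm (w - y))
    <= gamma^-1 * (enorm (x - w) `^ (1 + nu) / (1 + nu)).
  by rewrite ler_wpM2l ?invr_ge0 ?(ltW gamma0)//; move: h1 h2; atoms_lra.
have e : edot (grad f x) (w - x) = edot (grad f x) (y - x) + edot (grad f x) (w - y).
  by rewrite -edotDr [(y - x) + _]addrC subrKA.
move: h3; rewrite /hifbe_model e invfM; atoms_lra.
Qed.

(** Fermat's rule by hand: minimality and [normpow_expansion] with increment [y - w] minorize [g w]
    by an affine function up to [4 / gamma * |w - y|^(1 + nu)], which is negligible after division
    by [|w - y|]. *)
Lemma hifbe_argmin_subdiff x y : 0 < nu <= 1 -> 0 < gamma -> hifbe_argmin x y ->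
  frechet_subdiff g y (gamma^-1 *: normpow_grad nu (x - y) - grad f x).
Proof.
move=> nu01 gamma0 [gy ymin]; split => //; set zeta := (X in edot X).
have nu0 : 0 < nu by case/andP: nu01.
have p0 : 0 < 1 + nu by rewrite addr_gt0.
have c0 : 0 < 4 / gamma by rewrite divr_gt0.
have [gr gE] : exists gr, g y = gr%:E by exists (fine (g y)); rewrite fineK.
have low w : (g y + (edot zeta (w - y) - 4 / gamma * enorm (w - y) `^ (1 + nu))%:E <= g w)%E.
  have := ymin w; case: (g w) => [r| |]; last 2 first.
  - by move=> _; exact: leey.
  - by rewrite gE.
  move=> h; have {h} : hifbe_model x y + gr <= hifbe_model x w + r.
    by rewrite -lee_fin !EFinD -gE.
  rewrite gE -EFinD lee_fin.
  have := normpow_expansion (x - y) (y - w) nu01.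
  have -> : x - y + (y - w) = x - w by rewrite subrKA.
  rewrite (enorm_distC y w) => /(ler_wpM2l (_ : 0 <= gamma^-1)).
  rewrite invr_ge0 ltW// => /(_ isT).
  by rewrite /hifbe_model /zeta !edotE invfM; atoms_lra.
rewrite limf_einfE; apply/lee_addgt0Pr => e e0.
have [d d0 de] := powR_lt_near0 nu0 c0 e0.
rewrite -leeBlDr// add0e; apply: le_ereal_sup_tmp.
exists (ereal_inf [set ((g w - g y - (edot zeta (w - y))%:E)
    * ((enorm (w - y))^-1)%:E)%E | w in [set w | w != y /\ enorm (w - y) < d]]).
  exists [set w | w != y /\ enorm (w - y) < d] => //.
  rewrite /dnbhs /within /=; apply/nbhs_eball; exists d => // w wd wy; split => //.
apply: le_ereal_inf_tmp => _ [w [wy wd] <-].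
have nw : 0 < enorm (w - y) by rewrite lt_def enorm_eq0 subr_eq0 wy enorm_ge0.
have := low w; have := ymin w; case: (g w) => [r| |] _.
- rewrite gE -EFinD lee_fin => h; change (- e <= (r - gr - edot zeta (w - y)) * (enorm (w - y))^-1).
  rewrite ler_pdivlMr//; have := de _ (enorm_ge0 _) wd.
  move=> /ltW /(ler_wpM2r (enorm_ge0 (w - y))).
  rewrite -mulrA [_ `^ _ * _]mulrC.
  have := @mulr_powRB1 _ (enorm (w - y)) (1 + nu) (enorm_ge0 _) p0.
  rewrite [1 + nu]addrC addrK [nu + 1]addrC => ->.
  by move: h; atoms_lra.
- by move=> _; rewrite gE /= gt0_mulye ?leey// lte_fin invr_gt0.
- by rewrite gE.
Qed.

End ProximalModel.

Section Argmin.
Context {R : realType} {n : nat}.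
Context (nu gamma L M : R) (f : 'rV[R]_n -> R) (g : 'rV[R]_n -> \bar R).
Implicit Types (x y w h : 'rV[R]_n).

(** [a] is at most twice the larger of [b] and [c], and [2 ^ p <= 4]. This is the 4 in
    [L + 4 * M]. *)
Lemma powR_le_split (a b c p : R) : 0 <= p <= 2 -> 0 <= a -> 0 <= b -> 0 <= c ->
  a <= b + c -> a `^ p <= 4 * (b `^ p + c `^ p).
Proof.
move=> /andP[p0 p2] a0; wlog bc : b c / b <= c.
  move=> H b0 c0 abc; have /orP[bc|cb] := le_total b c; first exact: H.
  by rewrite [b `^ p + _]addrC H// addrC.
move=> b0 c0 abc; apply: (@le_trans _ _ ((2 * c) `^ p)).
  by rewrite ge0_ler_powR ?nnegrE ?mulr_ge0//; lra.
rewrite powRM//; apply: ler_pM; rewrite ?powR_ge0 ?lerDr ?powR_ge0//.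
have -> : 4 = 2 `^ 2%:R :> R by rewrite powR_mulrn//; lra.
by rewrite ler_powR// ler1n.
Qed.

Let c := ((1 + nu) * gamma)^-1.

(** Let [X], [Z] be the powers [1 + nu] of [|x|], [|x - y|]. Descent at [y] and at 0 gives
    [f y + g y + (c - L) Z <= (c + L) X], and calmness gives [f y + g y >= - 4 M (X + Z)]. As
    [L + 4 M <= c / 2], this yields [(c / 2) Z <= (3 c / 2) X]; then [4 M (X + 3 X) <= 2 c X] gives
    the last bound. Only [y] doing at least as well as 0 is assumed, so the estimate also serves on
    sublevel sets, before a minimizer is known to exist. *)
Lemma hifbe_argmin_powR x y : 0 < nu <= 1 -> 0 <= L -> 0 <= M ->
  2 * (L + 4 * M) <= c ->
  (forall z, differentiable f z) -> holder_gradient nu L f ->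
  (forall z, (- f z - M * enorm z `^ (1 + nu))%:E <= g z)%E ->
  g 0 = (- f 0)%:E ->
  ((hifbe_model nu gamma f x y)%:E + g y <= (hifbe_model nu gamma f x 0)%:E + g 0)%E ->
  [/\ c * enorm (x - y) `^ (1 + nu) <= c * (3 * enorm x `^ (1 + nu)),
      (g y <= (- f y + 2 * c * enorm x `^ (1 + nu))%:E)%E &
      ((- f y - 2 * c * enorm x `^ (1 + nu))%:E <= g y)%E].
Proof.
move=> nu01 L0 M0 cLM df hf low g0E hmin; have /andP[nu0 nu1] := nu01.
have [r rE] : exists r, g y = r%:E.
  have := low y; move: hmin; rewrite g0E.
  by case: (g y) => [r _ _| |] //; exists r.
have {}hmin : f x + edot (grad f x) (y - x) + c * enorm (x - y) `^ (1 + nu) + r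
  <= f x + edot (grad f x) (- x) + c * enorm x `^ (1 + nu) + (- f 0).
  by rewrite -lee_fin; move: hmin; rewrite rE g0E /hifbe_model subr0 sub0r.
have lowy := low y; rewrite rE lee_fin in lowy.
have y_le : enorm y <= enorm x + enorm (x - y).
  by rewrite -{1}(subKr x y) enormB.
have := @powR_le_split (enorm y) (enorm x) (enorm (x - y)) (1 + nu).
rewrite !enorm_ge0 => /(_ _ isT isT isT y_le) hY.
have {}hY : enorm y `^ (1 + nu)
    <= 4 * (enorm x `^ (1 + nu) + enorm (x - y) `^ (1 + nu)) by apply: hY; lra.
have := descent x y (ltW nu0) L0 df hf; rewrite (enorm_distC y x) ler_norml.
move=> /andP[_ h1].
have := descent x 0 (ltW nu0) L0 df hf; rewrite add0r enormN ler_norml.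
move=> /andP[h2 _].
have X0 : 0 <= enorm x `^ (1 + nu) := powR_ge0 _ _.
have Z0 : 0 <= enorm (x - y) `^ (1 + nu) := powR_ge0 _ _.
have MY := ler_wpM2l M0 hY.
have cX := ler_wpM2r X0 cLM; have cZ := ler_wpM2r Z0 cLM.
have m0 : 0 <= M * enorm x `^ (1 + nu) by rewrite mulr_ge0.
have m1 : 0 <= M * enorm (x - y) `^ (1 + nu) by rewrite mulr_ge0.
have l0 : 0 <= L * enorm x `^ (1 + nu) by rewrite mulr_ge0.
have l1 : 0 <= L * enorm (x - y) `^ (1 + nu) by rewrite mulr_ge0.
rewrite rE !lee_fin.
move: hmin lowy h1 h2 MY cX cZ m0 m1 l0 l1.
generalize (enorm x `^ (1 + nu)) (enorm y `^ (1 + nu)) (enorm (x - y) `^ (1 + nu)) c.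
generalize (edot (grad f x) (y - x)) (edot (grad f x) (- x)) (f x) (f y) (f 0).
clear; move=> e1 e2 fx fy f0 X Y Z c hmin lowy h1 h2 MY cX cZ m0 m1 l0 l1.
split; lra.
Qed.

End Argmin.

Section ArgminExistence.
Context {R : realType} {n : nat}.
Context (nu gamma L M : R) (f : 'rV[R]_n -> R) (g : 'rV[R]_n -> \bar R).
Implicit Types (x y w h : 'rV[R]_n).

Let c := ((1 + nu) * gamma)^-1.

Lemma enorm_le_of_powR x y : 0 < nu ->
  enorm y `^ (1 + nu) <= 3 * enorm x `^ (1 + nu) -> enorm y <= 3 * enorm x.
Proof.
move=> nu0 h; rewrite leNgt; apply/negP => xy; move: h; apply/negP.
rewrite -ltNge; have p0 : 0 < 1 + nu by rewrite addr_gt0.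
apply: (@le_lt_trans _ _ ((3 * enorm x) `^ (1 + nu))).
  rewrite powRM ?enorm_ge0// ler_wpM2r ?powR_ge0// le1r_powR ?ler1n//.
  by rewrite lerDl ltW.
by rewrite gt0_ltr_powR// nnegrE ?mulr_ge0 ?enorm_ge0.
Qed.

Lemma le_hifbe_model x y : 0 <= nu -> 0 <= L -> L <= c ->
  (forall z, differentiable f z) -> holder_gradient nu L f ->
  f y <= hifbe_model nu gamma f x y.
Proof.
move=> nu0 L0 Lc df hf; have := descent x y nu0 L0 df hf.
rewrite (enorm_distC y x) ler_norml /hifbe_model -/c => /andP[_].
have := ler_wpM2r (powR_ge0 (enorm (x - y)) (1 + nu)) Lc.
by move: c; atoms_lra.
Qed.

Lemma hifbe_argmin_exists x : 0 < nu <= 1 -> 0 < gamma -> 0 <= L -> 0 <= M ->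
  2 * (L + 4 * M) <= c ->
  (forall z, differentiable f z) -> holder_gradient nu L f ->
  (forall z, (- f z - M * enorm z `^ (1 + nu))%:E <= g z)%E ->
  g 0 = (- f 0)%:E -> lower_semicontinuous g ->
  exists y, hifbe_argmin nu gamma f g x y.
Proof.
move=> nu01 gamma0 L0 M0 cLM df hf low g0E lsc; have /andP[nu0 nu1] := nu01.
have c0 : 0 < c by rewrite invr_gt0 mulr_gt0// addr_gt0.
pose psi (y : 'rV[R]_n) := ((hifbe_model nu gamma f x y)%:E + g y)%E.
have dist_le y : (psi y <= psi 0%R)%E -> c * enorm (x - y) `^ (1 + nu)
      <= c * (3 * enorm x `^ (1 + nu)).
  by move=> h; have [] := hifbe_argmin_powR nu01 L0 M0 cLM df hf low g0E h.
have lscpsi : lower_semicontinuous psi.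
  by apply: lower_semicontinuous_add lsc => y; exact: hifbe_model_lsc.
have fin0 : psi 0 \is a fin_num by rewrite /psi g0E.
(* Above the level of the origin [psi 0] is the bound; below it, the model majorizes [f] and the
   last estimate of [hifbe_argmin_powR] applies. *)
have hb y : ((Num.min (fine (psi 0)) (- (2 * c * enorm x `^ (1 + nu))))%:E <= psi y)%E.
  have [h|/ltW h] := leP (psi y) (psi 0); last first.
    by apply: le_trans h; rewrite -(fineK fin0) lee_fin ge_min lexx.
  have [_ _] := hifbe_argmin_powR nu01 L0 M0 cLM df hf low g0E h.
  have Lc : L <= c by lra.
  have hm := le_hifbe_model x y (ltW nu0) L0 Lc df hf.
  move=> hg; apply: le_trans (leeD (hm : (_%:E <= _%:E)%E) hg).
  rewrite -EFinD lee_fin ge_min; apply/orP; right.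
  by rewrite addrA subrr sub0r lexx.
have [|y ymin] := lower_semicontinuous_argmin lscpsi fin0 hb (K := 4 * enorm x).
  move=> y /dist_le; rewrite ler_pM2l// => /(enorm_le_of_powR nu0) h.
  by rewrite -(subKr x y); apply: le_trans (enormB _ _) _; lra.
exists y; split => //.
have := ymin 0; have := low y; rewrite /psi g0E.
by case: (g y).
Qed.

End ArgminExistence.

(** * Hoelder dependence of the displacement on the base point *)

Section Stability.
Context {R : realType} {n : nat}.
Implicit Types (nu gamma L rho : R) (x y z h : 'rV[R]_n).

Lemma argmin_holder nu gamma L rho (f : 'rV[R]_n -> R) x1 x2 y1 y2 :
  0 < nu <= 1 -> 0 < gamma -> 0 <= L -> 0 <= rho ->
  4 * rho <= nu / gamma -> holder_gradient nu L f ->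
  enorm (x1 - y1) <= 1 -> enorm (x2 - y2) <= 1 -> enorm (x1 - x2) <= 1 ->
  - rho * enorm (y1 - y2) ^+ 2 <=
  edot ((gamma^-1 *: normpow_grad nu (x1 - y1) - grad f x1)
        - (gamma^-1 *: normpow_grad nu (x2 - y2) - grad f x2)) (y1 - y2) ->
  enorm ((x1 - y1) - (x2 - y2)) <=
  (2 * (gamma / nu) * (2 / gamma + 3 * L + 2 * rho) + 1)
    * enorm (x1 - x2) `^ (nu / 2).
Proof.
move=> nu01 gamma0 L0 rho0 rhoc hf; have /andP[nu0 nu1] := nu01.
set z1 := x1 - y1; set z2 := x2 - y2; set D1 := normpow_grad nu z1.
set D2 := normpow_grad nu z2; set F := grad f x1 - grad f x2.
move=> z11 z21 d1.
have e1 : y1 - y2 = (x1 - x2) - (z1 - z2).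
  by rewrite /z1 /z2; apply/rowP => i; rewrite !mxE; ring.
have e2 : gamma^-1 *: D1 - grad f x1 - (gamma^-1 *: D2 - grad f x2)
   = gamma^-1 *: (D1 - D2) - F.
  rewrite /F; move: (grad f x1) (grad f x2); clearbody D1 D2 => g1 g2.
  by apply/rowP => i; rewrite !mxE; ring.
rewrite e2 => hyp.
have mono := normpow_grad_monotone nu01 z11 z21; rewrite -/D1 -/D2 in mono.
have normD z : enorm z <= 1 -> enorm (normpow_grad nu z) <= 1.
  move=> z_1; rewrite enorm_normpow_grad//.
  have <- : 1 `^ nu = 1 :> R by rewrite powR1.
  by rewrite ge0_ler_powR ?nnegrE ?enorm_ge0// ltW.
have hF := hf x2 x1; rewrite -/F in hF.
set d := enorm (x1 - x2) in hF d1 *; set a := enorm (z1 - z2) in mono *.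
have hDD : edot (D1 - D2) (x1 - x2) <= 2 * d.
  apply: le_trans (cauchy_schwarz _ _) _; rewrite -/d ler_wpM2r ?enorm_ge0//.
  by apply: le_trans (enormB _ _) _; have := normD _ z11; have := normD _ z21; lra.
have hFy : - edot F (y1 - y2) <= L * d `^ nu * (d + a).
  rewrite -edotNl; apply: le_trans (cauchy_schwarz _ _) _; rewrite enormN.
  by apply: ler_pM; rewrite ?enorm_ge0// e1 enormB.
have hy : enorm (y1 - y2) ^+ 2 <= (d + a) ^+ 2.
  by rewrite ler_sqr ?nnegrE ?addr_ge0 ?enorm_ge0// e1 enormB.
have a0 : 0 <= a by exact: enorm_ge0.
have d0 : 0 <= d by exact: enorm_ge0.
have a2 : a <= 2 by apply: le_trans (enormB _ _) _; move: z11 z21; lra.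
have dnu : d <= d `^ nu.
  have [->|dn0] := eqVneq d 0; first exact: powR_ge0.
  by rewrite ger1_powR// d1 lt_def dn0 d0.
have hd2 : d ^+ 2 <= d `^ nu.
  by apply: le_trans dnu; rewrite expr2 ler_piMl.
have da2 : (d + a) ^+ 2 <= 2 * d ^+ 2 + 2 * a ^+ 2.
  by rewrite -subr_ge0; have := sqr_ge0 (d - a); lra.
have key : edot (gamma^-1 *: (D1 - D2) - F) (y1 - y2) =
    gamma^-1 * edot (D1 - D2) (x1 - x2) - gamma^-1 * edot (D1 - D2) (z1 - z2)
    - edot F (y1 - y2).
  by rewrite edotDl edotNl edotZl {1}e1 edotDr edotNr mulrBr.
rewrite key in hyp.
have gi0 : 0 <= gamma^-1 by rewrite invr_ge0 ltW.
have k1 := ler_wpM2l gi0 mono; have k2 := ler_wpM2l gi0 hDD.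
have k3 := ler_wpM2l gi0 dnu.
have k4 := ler_wpM2l rho0 (le_trans hy da2); have k5 := ler_wpM2l rho0 hd2.
have Ld0 : 0 <= L * d `^ nu by rewrite mulr_ge0 ?powR_ge0.
have k6 : L * d `^ nu * (d + a) <= L * d `^ nu * 3.
  by rewrite ler_wpM2l//; lra.
have k7 := ler_wpM2r (sqr_ge0 a) rhoc.
(* The hypomonotonicity term contributes [2 rho a^2], at most half of [nu / gamma * a^2] by [rhoc].
   Absorbing it doubles the constant; the 3 bounds [d + a], and [d] and [d^2] are replaced by
   [d^nu]. *)
have {k1 k2 k3 k4 k5 k6 k7 mono hDD hFy hyp} main :
    nu / gamma * a ^+ 2 <= 2 * (2 / gamma + 3 * L + 2 * rho) * d `^ nu.
  move: k1 k2 k3 k4 k5 k6 k7 hFy hyp.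
  generalize (edot (D1 - D2) (x1 - x2)) (edot (D1 - D2) (z1 - z2)).
  generalize (edot F (y1 - y2)) (enorm (y1 - y2)) (d `^ nu) gamma^-1.
  by clear; clearbody a d; move=> *; lra.
have {main} : a ^+ 2 <= 2 * (gamma / nu) * (2 / gamma + 3 * L + 2 * rho) * d `^ nu.
  rewrite -(ler_pM2l (_ : 0 < nu / gamma)) ?divr_gt0//.
  apply: le_trans main _; rewrite le_eqVlt; apply/orP; left; apply/eqP.
  by field; rewrite !gt_eqF.
set C := 2 * _ * _.
have C0 : 0 <= C.
  by rewrite /C !(mulr_ge0, addr_ge0) ?invr_ge0// ltW.
have -> : d `^ nu = (d `^ (nu / 2)) ^+ 2.
  by rewrite -powR_mulrn ?powR_ge0// -powRrM; congr (_ `^ _); field.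
have t0 : 0 <= d `^ (nu / 2) by exact: powR_ge0.
move: (d `^ (nu / 2)) t0 => t t0 h.
(* [C <= (C + 1)^2] replaces the square root of [C]. *)
rewrite -ler_sqr ?nnegrE ?mulr_ge0 ?addr_ge0//.
apply: le_trans h _; rewrite exprMn ler_wpM2r ?sqr_ge0//.
by rewrite -subr_ge0; have := mulr_ge0 C0 C0; lra.
Qed.

End Stability.

(** * Gradient of the envelope *)

Lemma fine_add_le (R : realType) (a b : R) (x y : \bar R) :
  x \is a fin_num -> y \is a fin_num ->
  (a%:E + x <= b%:E + y)%E -> a + fine x <= b + fine y.
Proof. by case: x => [r| |] //; case: y. Qed.

Section EnvelopeGradient.
Context {R : realType} {n : nat}.
Context (nu gamma L : R) (f : 'rV[R]_n -> R) (g : 'rV[R]_n -> \bar R).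
Implicit Types (x y h : 'rV[R]_n).

(* The partial gradient in [x] of [hifbe_model nu gamma f x y]; the transpose is
   there because the symmetry of the Hessian is never established. *)
Definition hifbe_model_grad x y : 'rV[R]_n :=
  gamma^-1 *: normpow_grad nu (x - y) - (x - y) *m (hessian f x)^T.

(** The remainder depends on [y] only through [|x - y|], so the expansion also applies at the
    minimizer for [x + h], which moves with [h]. One [L] comes from descent, the other from pairing
    the increment of [grad f] with [h]. *)
Lemma hifbe_model_expansion x y h : 0 < nu <= 1 -> 0 < gamma -> 0 <= L ->
  (forall z, differentiable f z) -> holder_gradient nu L f ->
  `|hifbe_model nu gamma f (x + h) y - hifbe_model nu gamma f x y
    - edot (hifbe_model_grad x y) h| <=
  (2 * L + 4 / gamma) * enorm h `^ (1 + nu)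
  + enorm (grad f (x + h) - grad f x - h *m hessian f x) * enorm (x - y).
Proof.
move=> nu01 gamma0 L0 df hf; have /andP[nu0 nu1] := nu01.
set r := (X in enorm X * enorm (x - y)).
have Ehx : (x + h) - x = h by rewrite addrC addKr.
have r1 := descent x (x + h) (ltW nu0) L0 df hf; rewrite Ehx in r1.
have r2 : `|edot (grad f (x + h) - grad f x) h| <= L * enorm h `^ (1 + nu).
  apply: le_trans (norm_edot_le _ _) _.
  have := hf x (x + h); rewrite Ehx => /(ler_wpM2r (enorm_ge0 h))/le_trans; apply.
  rewrite -mulrA ler_wpM2l// mulrC.
  by rewrite -(@mulr_powRB1 _ (enorm h) (1 + nu)) ?enorm_ge0 ?addr_gt0// [1 + nu]addrC addrK.
have r3 := norm_edot_le r (x - y).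
have Er3 : edot r (x - y) = edot (grad f (x + h) - grad f x) (x - y)
    - edot h ((x - y) *m (hessian f x)^T).
  by rewrite /r edotDl edotNl edot_mulmx.
have r4 := normpow_expansion (x - y) h nu01.
have r5 := normpow_subgrad (x - y) (x - y + h) nu0.
have Exy : x - y + h = x + h - y by rewrite addrAC.
have Exh : x - y + h - (x - y) = h by rewrite addrC addKr.
rewrite Exh in r5; rewrite Exy in r4 r5.
have gi0 : 0 <= gamma^-1 by rewrite invr_ge0 ltW.
have {}r4 := ler_wpM2l gi0 r4; have {}r5 := ler_wpM2l gi0 r5.
have Ey : edot (grad f (x + h)) (y - (x + h)) - edot (grad f x) (y - x)
   = - edot (grad f (x + h) - grad f x) (x - y)
     - edot (grad f (x + h) - grad f x) h - edot (grad f x) h.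
  by move: (grad f (x + h)) (grad f x) => g1 g2; clear; rewrite !edotE; atoms_lra.
have EG : edot (hifbe_model_grad x y) h = gamma^-1 * edot (normpow_grad nu (x - y)) h
    - edot h ((x - y) *m (hessian f x)^T).
  by rewrite /hifbe_model_grad edotDl edotNl edotZl [edot (_ *m _) h]edotC.
have Ec : ((1 + nu) * gamma)^-1 = (1 + nu)^-1 * gamma^-1 by rewrite invfM.
rewrite EG /hifbe_model Ec.
move: r1 r2 r3 r4 r5 Er3 Ey.
generalize (edot r (x - y)) (edot (grad f (x + h) - grad f x) (x - y)).
generalize (edot h ((x - y) *m (hessian f x)^T)) (edot (normpow_grad nu (x - y)) h).
generalize (edot (grad f (x + h) - grad f x) h) (edot (grad f x) h).
generalize (edot (grad f (x + h)) (y - (x + h))) (edot (grad f x) (y - x)).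
generalize (enorm r) (enorm (x - y)) (enorm (x + h - y)) (enorm h).
generalize (f (x + h)) (f x) gamma^-1.
clear; move=> f1 f2 gi er exy ehy eh a1 a2 a3 a4 a5 a6 a7 a8.
rewrite !ler_norml => /andP[? ?] /andP[? ?] /andP[? ?] ? ? ? ?.
by apply/andP; split; lra.
Qed.

Lemma hifbe_model_grad_diff x1 x2 y1 y2 : 0 < nu <= 1 -> 0 < gamma ->
  enorm (hifbe_model_grad x1 y1 - hifbe_model_grad x2 y2) <=
  4 / gamma * enorm ((x1 - y1) - (x2 - y2)) `^ nu
  + opnorm (hessian f x1) * enorm ((x1 - y1) - (x2 - y2))
  + opnorm (hessian f x1 - hessian f x2) * enorm (x2 - y2).
Proof.
move=> nu01 gamma0; rewrite /hifbe_model_grad.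
move: (x1 - y1) (x2 - y2) (hessian f x1) (hessian f x2) => z1 z2 H1 H2.
have -> : gamma^-1 *: normpow_grad nu z1 - z1 *m H1^T
      - (gamma^-1 *: normpow_grad nu z2 - z2 *m H2^T)
    = gamma^-1 *: (normpow_grad nu z1 - normpow_grad nu z2)
      - ((z1 - z2) *m H1^T + z2 *m (H1 - H2)^T).
  have -> : (H1 - H2)^T = H1^T - H2^T by rewrite linearB.
  rewrite mulmxBl mulmxBr scalerBr.
  by rewrite subrKA 2!opprB addrACA [RHS]addrACA; congr (_ + _); exact: addrC.
apply: le_trans (enormB _ _) _; rewrite -addrA; apply: lerD.
  rewrite enormZ ger0_norm ?invr_ge0 ?(ltW gamma0)// [4 / _]mulrC -mulrA.
  by rewrite ler_wpM2l ?invr_ge0 ?(ltW gamma0)// normpow_grad_holder.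
by apply: le_trans (enormD _ _) _; rewrite lerD// enorm_mulmx_tr.
Qed.

Lemma hifbe_has_grad x (Y : 'rV[R]_n -> 'rV[R]_n) (r0 : R) :
  0 < nu <= 1 -> 0 < gamma -> 0 <= L ->
  (forall z, differentiable f z) -> holder_gradient nu L f ->
  differentiable (grad f) x -> 0 < r0 ->
  (forall h, enorm h < r0 -> hifbe_argmin nu gamma f g (x + h) (Y (x + h))) ->
  (forall e : R, 0 < e -> exists2 d : R, 0 < d &
     forall h, enorm h < d -> enorm (Y (x + h) - Y x) < e) ->
  differentiable (fun x => fine (hifbe (1 + nu) gamma f g x)) x /\
  grad (fun x => fine (hifbe (1 + nu) gamma f g x)) x = hifbe_model_grad x (Y x).
Proof.
move=> nu01 gamma0 L0 df hf dgf r00 Ymin Ycont; have /andP[nu0 nu1] := nu01.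
have Ymin0 : hifbe_argmin nu gamma f g x (Y x).
  by have := Ymin _ (_ : enorm 0 < r0); rewrite addr0; apply; rewrite enorm0.
apply: grad_unique => e e0.
have e3 : 0 < e / 3 by lra.
(* The extra 1 leaves room for the minimizer at [x + h], which is within distance 1 of [Y x]. *)
pose b := enorm (x - Y x) + 1.
have b0 : 0 < b by rewrite ltr_wpDl ?enorm_ge0.
have [d1 d10 rem] := grad_remainder dgf (divr_gt0 e3 b0).
have [d2 d20 pow] : exists2 d : R, 0 < d & forall t, 0 <= t -> t < d ->
    (2 * L + 4 / gamma) * t `^ nu < e / 3.
  by apply: powR_lt_near0 => //; rewrite ltr_wpDl ?mulr_ge0 ?divr_gt0.
have [d3 d30 pow3] : exists2 d : R, 0 < d & forall t, 0 <= t -> t < d ->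
    4 / gamma * t `^ nu < e / 6.
  by apply: powR_lt_near0 => //; rewrite ?divr_gt0.
pose o := opnorm (hessian f x) + 1.
have o0 : 0 < o by rewrite ltr_wpDl ?opnorm_ge0.
have m0 : 0 < Num.min (Num.min 1 d3) (e / 6 / o).
  by rewrite !lt_min ltr01 d30 !divr_gt0.
have [d4 d40 Yd] := Ycont _ m0.
exists (Num.min (Num.min r0 d1) (Num.min d2 d4)).
  by rewrite !lt_min r00 d10 d20 d40.
move=> h; rewrite !lt_min => /andP[/andP[hr0 hd1] /andP[hd2 hd4]].
have := Yd _ hd4; rewrite !lt_min => /andP[/andP[Y1 Y3] Yo].
set y := Y x in Ymin0 b b0 rem Y1 Y3 Yo *; set y' := Y (x + h) in Y1 Y3 Yo.
have Ymin' : hifbe_argmin nu gamma f g (x + h) y' by exact: Ymin.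
have errle z : enorm (x - z) <= b ->
    `|hifbe_model nu gamma f (x + h) z - hifbe_model nu gamma f x z
      - edot (hifbe_model_grad x z) h| <= 2 * (e / 3) * enorm h.
  move=> zb; apply: le_trans (hifbe_model_expansion x z h nu01 gamma0 L0 df hf) _.
  have q1 : (2 * L + 4 / gamma) * enorm h `^ (1 + nu) <= e / 3 * enorm h.
    rewrite -(@mulr_powRB1 _ (enorm h) (1 + nu)) ?enorm_ge0 ?addr_gt0//.
    rewrite [1 + nu]addrC addrK mulrCA mulrC ler_wpM2r ?enorm_ge0//.
    exact/ltW/pow/hd2/enorm_ge0.
  have q2 : enorm (grad f (x + h) - grad f x - h *m hessian f x) * enorm (x - z)
      <= e / 3 * enorm h.
    apply: (@le_trans _ _ (e / 3 / b * enorm h * b)).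
      by rewrite ler_pM ?enorm_ge0// rem.
    by rewrite mulrAC divfK// gt_eqF.
  have -> : 2 * (e / 3) * enorm h = e / 3 * enorm h + e / 3 * enorm h by rewrite -mulrA mulr2n mulrDl mul1r.
  exact: lerD.
have yb : enorm (x - y) <= b by rewrite lerDl.
have err0 := errle y yb.
have xy' : enorm (x - y') <= b.
  have -> : x - y' = (x - y) - (y' - y) by rewrite opprB addrA subrK.
  by apply: le_trans (enormB _ _) _; rewrite lerD2l ltW.
have err1 := errle y' xy'.
(* Both gradients are taken at the same [x], so the Hessian difference vanishes and only the motion
   from [y] to [y'] counts. *)
have hG : `|edot (hifbe_model_grad x y' - hifbe_model_grad x y) h| <= e / 3 * enorm h.
  apply: le_trans (norm_edot_le _ _) _; rewrite ler_wpM2r ?enorm_ge0//.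
  apply: le_trans (hifbe_model_grad_diff _ _ _ _ nu01 gamma0) _.
  have -> : x - y' - (x - y) = - (y' - y) by rewrite opprB addrC subrKA opprB.
  have -> : opnorm (hessian f x - hessian f x) = 0.
    apply/eqP; rewrite eq_le opnorm_ge0 andbT; apply: le_trans (opnorm_le_mxnorm _) _.
    by rewrite subrr normr0 !mulr0.
  rewrite mul0r addr0 enormN.
  have := pow3 _ (enorm_ge0 _) Y3.
  have : opnorm (hessian f x) * enorm (y' - y) <= e / 6.
    apply: (@le_trans _ _ (o * (e / 6 / o))); last by rewrite mulrC divfK// gt_eqF.
    by rewrite ler_pM ?opnorm_ge0 ?enorm_ge0 ?lerDl// ltW.
  by move: e0; atoms_lra.
have {Ymin Ycont Yd rem pow pow3} [Fx Fh] := (hifbe_argminE Ymin0, hifbe_argminE Ymin').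
rewrite Fx Fh /=.
case: Ymin0 Ymin' => gy ymin [gy' ymin'].
(* Testing [y] at [x + h] bounds the increment of the envelope above by that of the model at [y];
   testing [y'] at [x] bounds it below by that at [y']. *)
have up := fine_add_le gy' gy (ymin' y).
have dn := fine_add_le gy gy' (ymin y').
move: err0 err1 hG up dn; rewrite edotDl edotNl.
generalize (edot (hifbe_model_grad x y) h) (edot (hifbe_model_grad x y') h).
generalize (hifbe_model nu gamma f x y) (hifbe_model nu gamma f x y').
generalize (hifbe_model nu gamma f (x + h) y) (hifbe_model nu gamma f (x + h) y').
generalize (fine (g y)) (fine (g y')) (enorm h).
clear; move=> g1 g2 nh m1 m2 m3 m4 a1 a2.
rewrite !ler_norml => /andP[? ?] /andP[? ?] /andP[? ?] ? ?.
by apply/andP; split; lra.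
Qed.

End EnvelopeGradient.

(** * From stable minimizers to a continuous, then Hoelder, envelope gradient *)

Section Regularity.
Context {R : realType} {n : nat}.
Implicit Types (nu gamma L : R) (f : 'rV[R]_n -> R) (g : 'rV[R]_n -> \bar R).
Implicit Types (x y z h : 'rV[R]_n) (A B : 'M[R]_n).

Lemma opnorm_le_add A B : opnorm A <= opnorm B + opnorm (A - B).
Proof.
apply: ge_sup; first by case: (opnorm_has_sup A).
move=> _ [h /= h1 <-]; rewrite -{1}(subrK B A) mulmxDr addrC.
apply: le_trans (enormD _ _) _.
by apply: lerD; apply: le_trans (enorm_mulmx _ _) _; rewrite ler_piMr ?opnorm_ge0.
Qed.

Lemma frechet_limiting_subdiff (psi : 'rV[R]_n -> \bar R) x z :
  frechet_subdiff psi x z -> limiting_subdiff psi x z.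
Proof.
move=> h; split; first by case: h.
by exists (fun=> x), (fun=> z); split => //; exact: cvg_cst.
Qed.

Lemma powR_le_exp (d s t : R) : 0 <= d <= 1 -> 0 < s -> t <= s -> d `^ s <= d `^ t.
Proof.
move=> /andP[d0 d1] s0 ts; have [->|dn0] := eqVneq d 0.
  by rewrite powR0 ?gt_eqF// powR_ge0.
by rewrite ger_powR// lt_def dn0 d0.
Qed.

Lemma hifbe_regular nu gamma L f g (Y : 'rV[R]_n -> 'rV[R]_n) (r K b : R) :
  0 < nu <= 1 -> 0 < gamma -> 0 <= L ->
  (forall z, differentiable f z) -> holder_gradient nu L f ->
  C2_on (eball 0 r) f -> 0 < K -> r <= 1 / 2 ->
  (forall x, eball 0 r x -> hifbe_argmin nu gamma f g x (Y x)) ->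
  (forall x, eball 0 r x -> enorm (x - Y x) <= 1) ->
  (forall x1 x2, eball 0 r x1 -> eball 0 r x2 ->
     enorm ((x1 - Y x1) - (x2 - Y x2)) <= K * enorm (x1 - x2) `^ (nu / 2)) ->
  (forall x, eball 0 r x -> opnorm (hessian f x) <= b) ->
  let F := fun x => fine (hifbe (1 + nu) gamma f g x) in
  C1_on (eball 0 r) F /\
  forall mu Lmu : R, 0 < mu -> 0 < Lmu ->
    (forall x y, eball 0 r x -> eball 0 r y ->
      opnorm (hessian f x - hessian f y) <= Lmu * enorm (x - y) `^ mu) ->
    exists2 Leta : R, 0 < Leta &
      forall x1 x2, eball 0 r x1 -> eball 0 r x2 ->
        enorm (grad F x2 - grad F x1) <=
        Leta * enorm (x2 - x1) `^ Num.min mu (nu ^+ 2 / 2).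
Proof.
move=> nu01 gamma0 L0 df hf [d2f cH] K0 r2 Ymin Y1 Yhol Hb F.
have /andP[nu0 nu1] := nu01.
have c0 : 0 < 4 / gamma by rewrite divr_gt0.
have nu20 : 0 < nu / 2 by rewrite divr_gt0.
have nusq0 : 0 < nu ^+ 2 / 2 by rewrite divr_gt0// exprn_gt0.
have Fgrad x : eball 0 r x ->
    differentiable F x /\ grad F x = hifbe_model_grad nu gamma f x (Y x).
  move=> xr; have nx : enorm x < r by move: xr; rewrite /eball/= subr0.
  have xhr h : enorm h < r - enorm x -> eball 0 r (x + h).
    move=> hr; rewrite /eball/= subr0; apply: le_lt_trans (enormD _ _) _.
    by rewrite -ltrBrDl.
  apply: (hifbe_has_grad (r0 := r - enorm x) nu01 gamma0 L0 df hf).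
  - by case: (d2f x xr).
  - by rewrite subr_gt0.
  - by move=> h /xhr/Ymin.
  move=> e e0; have e20 : 0 < e / 2 by rewrite divr_gt0.
  have [d d0 dK] := powR_lt_near0 nu20 K0 e20.
  exists (Num.min (r - enorm x) (Num.min d (e / 2))).
    by rewrite !lt_min subr_gt0 nx d0.
  move=> h; rewrite !lt_min => /andP[hr /andP[hd he]].
  have := Yhol _ _ (xhr h hr) xr; have -> : x + h - x = h by rewrite addrC addKr.
  have := dK _ (enorm_ge0 h) hd.
  have -> : Y (x + h) - Y x = h - (x + h - Y (x + h) - (x - Y x)).
    by apply/rowP => i; rewrite !mxE; ring.
  have := enormB h (x + h - Y (x + h) - (x - Y x)).
  by move: he; atoms_lra.
(* One estimate serves both claims: the Hessian difference is left as it is, to be handled by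
   continuity or by its Hoelder bound. [Num.max b 0] secures a nonnegative constant. *)
have gdiff x1 x2 : eball 0 r x1 -> eball 0 r x2 -> enorm (grad F x1 - grad F x2) <=
    4 / gamma * K `^ nu * enorm (x1 - x2) `^ (nu ^+ 2 / 2)
    + Num.max b 0 * K * enorm (x1 - x2) `^ (nu / 2)
    + opnorm (hessian f x1 - hessian f x2).
  move=> x1r x2r; have [_ ->] := Fgrad x1 x1r; have [_ ->] := Fgrad x2 x2r.
  apply: le_trans (hifbe_model_grad_diff _ _ _ _ _ nu01 gamma0) _.
  have hz := Yhol _ _ x1r x2r.
  apply: lerD; last by rewrite ler_piMr ?opnorm_ge0// Y1.
  apply: lerD; last first.
    rewrite -[leRHS]mulrA ler_pM ?opnorm_ge0 ?enorm_ge0//.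
    by rewrite le_max Hb.
  rewrite -[leRHS]mulrA ler_wpM2l ?(ltW c0)//.
  have -> : K `^ nu * enorm (x1 - x2) `^ (nu ^+ 2 / 2)
      = (K * enorm (x1 - x2) `^ (nu / 2)) `^ nu.
    rewrite powRM ?powR_ge0 ?(ltW K0)// -[_ `^ _ `^ nu]powRrM.
    by congr (_ * _ `^ _); field.
  by rewrite ge0_ler_powR ?nnegrE ?mulr_ge0 ?powR_ge0 ?enorm_ge0 ?(ltW K0) ?(ltW nu0).
have b0 : 0 <= Num.max b 0 by rewrite le_max lexx orbT.
have K1 : 0 < 4 / gamma * K `^ nu by rewrite mulr_gt0 ?powR_gt0.
split.
  move=> x xr; split; first by case: (Fgrad x xr).
  apply/(@cvg_enormP _ _ _ (nbhs x)) => e e0.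
  have e3 : 0 < e / 3 by rewrite divr_gt0.
  have [d1 d10 h1] := powR_lt_near0 nusq0 K1 e3.
  have K2 : 0 < Num.max b 0 * K + 1 by rewrite ltr_wpDl// mulr_ge0// ltW.
  have [d3 d30 h2] := powR_lt_near0 nu20 K2 e3.
  have [d4 d40 h3] := opnorm_continuous_at (cH x xr) e3.
  have nx : enorm x < r by move: xr; rewrite /eball/= subr0.
  apply/(nbhs_eball x).
  exists (Num.min (Num.min (r - enorm x) d1) (Num.min d3 d4)).
    by rewrite !lt_min subr_gt0 nx d10 d30.
  move=> y; rewrite /eball /= !lt_min => /andP[/andP[yr y1] /andP[y2 y3]].
  have {}yr : eball 0 r y.
    rewrite /eball/= subr0 -(subrK x y); apply: le_lt_trans (enormD _ _) _.
    by rewrite -ltrBrDr.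
  have k1 : 4 / gamma * K `^ nu * enorm (y - x) `^ (nu ^+ 2 / 2) < e / 3.
    exact: h1 (enorm_ge0 _) y1.
  have k2 : (Num.max b 0 * K + 1) * enorm (y - x) `^ (nu / 2) < e / 3.
    exact: h2 (enorm_ge0 _) y2.
  have := h3 _ y3; move: k1 k2 (gdiff y x yr xr).
  have := powR_ge0 (enorm (y - x)) (nu / 2).
  generalize (opnorm (hessian f y - hessian f x)) (enorm (grad F y - grad F x)).
  generalize (enorm (y - x) `^ (nu / 2)) (enorm (y - x) `^ (nu ^+ 2 / 2)) => t1 t2 o gF.
  generalize (Num.max b 0 * K) (4 / gamma * K `^ nu).
  by clear; move=> *; lra.
move=> mu Lmu mu0 Lmu0 Hmu; set eta := Num.min _ _.
have eta_mu : eta <= mu by rewrite ge_min lexx.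
have eta_sq : eta <= nu ^+ 2 / 2 by rewrite ge_min lexx orbT.
have eta_nu : eta <= nu / 2.
  apply: le_trans eta_sq _; rewrite ler_pM2r ?invr_gt0// expr2.
  by rewrite ler_piMl ?(ltW nu0).
exists (4 / gamma * K `^ nu + Num.max b 0 * K + Lmu).
  by rewrite ltr_wpDl// addr_ge0 ?(ltW K1)// mulr_ge0// ltW.
move=> x1 x2 x1r x2r; apply: le_trans (gdiff _ _ x2r x1r) _.
(* At distances at most 1 the smallest exponent dominates; [r <= 1 / 2] was asked for this. *)
have dist1 : 0 <= enorm (x2 - x1) <= 1.
  rewrite enorm_ge0/=; apply: le_trans (enormB _ _) _.
  move: x1r x2r r2; rewrite /eball/= !subr0.
  by clear; atoms_lra.
rewrite [leRHS]mulrDl [X in _ <= X + _]mulrDl; apply: lerD; first apply: lerD.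
- by rewrite ler_wpM2l ?(ltW K1)// powR_le_exp.
- by rewrite ler_wpM2l ?mulr_ge0 ?(ltW K0)// powR_le_exp.
- apply: le_trans (Hmu _ _ x2r x1r) _.
  by rewrite ler_wpM2l ?(ltW Lmu0)// powR_le_exp.
Qed.

End Regularity.

(** * Entering the prox-regularity neighbourhood, and the final assembly *)

Section Localization.
Context {R : realType} {n : nat}.
Implicit Types (nu gamma L M eps rho : R) (f : 'rV[R]_n -> R).
Implicit Types (psi g : 'rV[R]_n -> \bar R) (x y z : 'rV[R]_n).

(** As [g] is only lower semicontinuous, [y] near 0 does not make [g y] close to [g 0]; that follows
    from the two-sided bound on [f y + g y] in [hifbe_argmin_powR]. The bound [|x - y| <= 1] opens
    the way to strong monotonicity. *)
Lemma hifbe_argmin_local nu gamma L M f g eps : 0 < nu <= 1 -> 0 < gamma ->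
  0 <= L -> 0 <= M -> 2 * (L + 4 * M) <= ((1 + nu) * gamma)^-1 ->
  (forall z, differentiable f z) -> holder_gradient nu L f ->
  (forall z, (- f z - M * enorm z `^ (1 + nu))%:E <= g z)%E ->
  g 0 = (- f 0)%:E -> 0 < eps ->
  exists2 r : R, 0 < r & forall x y, enorm x < r -> hifbe_argmin nu gamma f g x y ->
    [/\ enorm y < eps, enorm (x - y) <= 1,
        enorm (gamma^-1 *: normpow_grad nu (x - y) - grad f x + grad f 0) < eps
      & (`|g y - g 0%R| < eps%:E)%E].
Proof.
move=> nu01 gamma0 L0 M0 cLM df hf low g0E eps0; have /andP[nu0 nu1] := nu01.
set c := _^-1 in cLM *.
have p0 : 0 < 1 + nu by rewrite addr_gt0.
have c0 : 0 < c by rewrite invr_gt0 mulr_gt0.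
have e2 : 0 < eps / 2 by rewrite divr_gt0.
have [d1 d10 h1] : exists2 d : R, 0 < d & forall y, enorm y < d -> `|f y - f 0| < eps / 2.
  have := differentiable_continuous (df 0).
  move=> /(@cvgrPdist_lt _ _ _ (nbhs (0 : 'rV[R]_n))) /(_ _ e2).
  move=> /(nbhs_eball (0 : 'rV[R]_n)) [d d0 dP]; exists d => // y yd.
  by rewrite distrC; apply: dP; rewrite /eball/= subr0.
have [d2 d20 h2] : exists2 d : R, 0 < d & forall t, 0 <= t -> t < d ->
    (L + 3 / gamma) * t `^ nu < eps.
  by apply: powR_lt_near0; rewrite // ltr_wpDl// divr_gt0.
have [d3 d30 h3] : exists2 d : R, 0 < d & forall t, 0 <= t -> t < d ->
    2 * c * t `^ (1 + nu) < eps / 2.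
  by apply: powR_lt_near0; rewrite // mulr_gt0.
(* The fractions match [|x - y| <= 3 |x|] and [|y| <= 4 |x|]. *)
exists (Num.min (Num.min d2 d3) (Num.min (1 / 3) (Num.min (d1 / 4) (eps / 4)))).
  by rewrite !lt_min d20 d30 !divr_gt0.
move=> x y; rewrite !lt_min => /andP[/andP[x2 x3] /andP[x4 /andP[x5 x6]]] [gy ymin].
have [hd hu hl] := hifbe_argmin_powR nu01 L0 M0 cLM df hf low g0E (ymin 0).
have xy : enorm (x - y) <= 3 * enorm x.
  by move: hd; rewrite ler_pM2l//; exact: enorm_le_of_powR.
have y4 : enorm y <= 4 * enorm x.
  rewrite -{1}(subKr x y); apply: le_trans (enormB _ _) _.
  by apply: le_trans (lerD (lexx _) xy) _; atoms_lra.
have k2 : (L + 3 / gamma) * enorm x `^ nu < eps by exact: h2 (enorm_ge0 _) x2.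
have k3 : 2 * c * enorm x `^ (1 + nu) < eps / 2 by exact: h3 (enorm_ge0 _) x3.
split.
- by apply: le_lt_trans y4 _; atoms_lra.
- by apply: le_trans xy _; atoms_lra.
- rewrite -addrA [- _ + _]addrC; apply: le_lt_trans (enormD _ _) _.
  apply: le_lt_trans k2; rewrite [leLHS]addrC mulrDl; apply: lerD.
    by have := hf x 0; rewrite sub0r enormN.
  rewrite enormZ ger0_norm ?invr_ge0 ?(ltW gamma0)// enorm_normpow_grad//.
  rewrite [3 / _]mulrC -mulrA ler_wpM2l ?invr_ge0 ?(ltW gamma0)//.
  apply: (@le_trans _ _ ((3 * enorm x) `^ nu)).
    by rewrite ge0_ler_powR ?nnegrE ?mulr_ge0 ?enorm_ge0 ?(ltW nu0).
  rewrite powRM ?enorm_ge0// ler_wpM2r ?powR_ge0//.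
  by apply: ler1_powR; rewrite ?ler1n.
have k1 : `|f y - f 0| < eps / 2 by apply: h1; apply: le_lt_trans y4 _; atoms_lra.
move: hu hl; rewrite g0E -(fineK gy) !lee_fin => hu hl.
change (`|fine (g y) - - f 0| < eps).
move: k1; rewrite !ltr_norml => /andP[k11 k12].
by move: k3 hu hl k11 k12; rewrite -/c; clear; move=> *; apply/andP; split; lra.
Qed.

Lemma prox_ineq_hypomonotone psi rho x1 x2 z1 z2 :
  psi x1 \is a fin_num -> psi x2 \is a fin_num ->
  (psi x1 + (edot z1 (x2 - x1) - rho / 2 * enorm (x2 - x1) ^+ 2)%:E <= psi x2)%E ->
  (psi x2 + (edot z2 (x1 - x2) - rho / 2 * enorm (x1 - x2) ^+ 2)%:E <= psi x1)%E ->
  - rho * enorm (x1 - x2) ^+ 2 <= edot (z1 - z2) (x1 - x2).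
Proof.
move=> f1 f2; rewrite -(fineK f1) -(fineK f2) -!EFinD !lee_fin.
rewrite (enorm_distC x2 x1) edotDl edotNl.
have -> : edot z1 (x2 - x1) = - edot z1 (x1 - x2) by rewrite -edotNr opprB.
by atoms_lra.
Qed.

End Localization.

(** The finiteness clause makes it legitimate to pass to [fine] in the two regularity claims. *)
Theorem theorem31 (R : realType) (n : nat) (nu p Lnu : R)
    (f : 'rV[R]_n -> R) (g : 'rV[R]_n -> \bar R) (U : set 'rV[R]_n)
    (hnu0 : 0 < nu) (hnu1 : nu <= 1) (hp : p = 1 + nu)
    (hLnu : 0 <= Lnu)
    (hfdiff : forall x : 'rV[R]_n, differentiable f x)
    (hfgrad : holder_gradient nu Lnu f)
    (hgproper : ext_proper g) (hglsc : lower_semicontinuous g)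
    (hcalm : calm_point p (fun x => ((f x)%:E + g x)%E) 0)
    (hphi0 : ((f 0%R)%:E + g 0%R = 0)%E)
    (hprox : prox_regular g 0 (- grad f 0))
    (hUopen : open U) (hU0 : U 0)
    (hfC2 : C2_on U f) :
  exists2 gammabar : R, 0 < gammabar &
    forall gamma : R, 0 < gamma -> gamma < gammabar ->
      exists2 r : R, 0 < r &
        [/\ (forall x, eball 0 r x -> hifbe p gamma f g x \is a fin_num),
            C1_on (eball 0 r) (fun x => fine (hifbe p gamma f g x))
          & forall mu Lmu : R, 0 < mu -> mu < 1 -> 0 < Lmu ->
            C2_holder_on mu Lmu U f ->
            exists2 Leta : R, 0 < Leta &
              forall x1 x2, eball 0 r x1 -> eball 0 r x2 ->
                enorm (grad (fun x => fine (hifbe p gamma f g x)) x2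
                       - grad (fun x => fine (hifbe p gamma f g x)) x1)
                <= Leta * enorm (x2 - x1) `^ Num.min mu (nu ^+ 2 / 2)].
Proof.
have nu01 : 0 < nu <= 1 by rewrite hnu0.
have p0 : 0 < 1 + nu by rewrite addr_gt0.
rewrite {}hp in hcalm *.
have g0E : g 0 = (- f 0)%:E.
  move: hphi0; case: (g 0) => [s| |] //; rewrite -EFinD => -[s0].
  by congr _%:E; apply/eqP; rewrite -addr_eq0 addrC s0.
have [_ [M M0 calm]] := hcalm; have {}M0 := ltW M0.
have low z : ((- f z - M * enorm z `^ (1 + nu))%:E <= g z)%E.
  have [->|z0] := eqVneq z 0.
    by rewrite g0E enorm0 powR0 ?gt_eqF// mulr0 subr0.
  have := calm z z0; rewrite hphi0 subr0; have := hgproper.1 z.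
  case: (g z) => [s _| |] //; last by move=> *; exact: leey.
  by rewrite -!EFinD lte_fin lee_fin => h; lra.
have [_ _ [eps [rho [eps0 rho0 prox]]]] := hprox.
(* Each summand encodes one demand on [gamma^-1]: the first gives existence and localization of
   minimizers, the second lets strong monotonicity beat hypomonotonicity. *)
pose B := 2 * (1 + nu) * (Lnu + 4 * M) + 4 * rho / nu.
have B0 : 0 < B.
  by rewrite ltr_wpDl ?mulr_ge0 ?addr_ge0 ?mulr_ge0 ?(ltW hnu0)// divr_gt0 ?mulr_gt0.
exists B^-1; first by rewrite invr_gt0.
move=> gamma gamma0 gammaB.
have Bg : B < gamma^-1 by rewrite -[B]invrK ltf_pV2 ?posrE ?invr_gt0.
have h0 : 0 <= 2 * (1 + nu) * (Lnu + 4 * M).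
  by rewrite ?mulr_ge0 ?addr_ge0 ?mulr_ge0 ?(ltW hnu0).
have h1 : 0 <= 4 * rho / nu by rewrite divr_ge0 ?mulr_ge0// ltW.
have cLM : 2 * (Lnu + 4 * M) <= ((1 + nu) * gamma)^-1.
  rewrite invfM -ler_pdivrMl ?invr_gt0// invrK mulrA [(1 + nu) * _]mulrC.
  by move: Bg; rewrite /B; lra.
have rhoc : 4 * rho <= nu / gamma.
  by rewrite -ler_pdivrMl// [nu^-1 * _]mulrC; move: Bg; rewrite /B; lra.
have exmin x := hifbe_argmin_exists x nu01 gamma0 hLnu M0 cLM hfdiff hfgrad low g0E hglsc.
have /choice[Y Ymin] := exmin.
have [r1 r10 loc] := hifbe_argmin_local nu01 gamma0 hLnu M0 cLM hfdiff hfgrad low g0E eps0.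
have [r2 r20 r2U] : exists2 r : R, 0 < r & eball 0 r `<=` U.
  by apply/nbhs_eball; exact: open_nbhs_nbhs.
have [r3 r30 Hnear] := opnorm_continuous_at (hfC2.2 0 hU0) ltr01.
(* The radii secure, in turn, localization, inclusion in [U], a Hessian within 1 of its value at 0,
   and mutual distances at most 1. *)
pose r := Num.min (Num.min r1 r2) (Num.min r3 (1 / 2)).
have r0 : 0 < r by rewrite !lt_min r10 r20 r30 divr_gt0.
have inball x : eball 0 r x ->
    [/\ enorm x < r1, U x, enorm (x - 0) < r3 & enorm x < 1 / 2].
  rewrite /eball/= !lt_min => /andP[/andP[xr1 xr2] /andP[xr3 xr4]].
  by split=> //; [rewrite -(subr0 x)|apply: r2U|rewrite -(subr0 x)].
exists r => //; pose K := 2 * (gamma / nu) * (2 / gamma + 3 * Lnu + 2 * rho) + 1.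
have K0 : 0 < K.
  have q1 : 0 < gamma / nu by rewrite divr_gt0.
  have q2 : 0 < 2 / gamma by rewrite divr_gt0.
  by rewrite ltr_wpDl// mulr_ge0//; lra.
have reg := @hifbe_regular R n nu gamma Lnu f g Y r K (opnorm (hessian f 0) + 1)
  nu01 gamma0 hLnu hfdiff hfgrad.
have [|||||||C1 Chol] := reg.
- split=> x /inball[_ Ux _ _]; [exact: hfC2.1|exact: hfC2.2].
- exact: K0.
- by rewrite !ge_min lexx !orbT.
- by move=> x _; exact: Ymin.
- by move=> x /inball[xr1 _ _ _]; have [] := loc _ _ xr1 (Ymin x).
- move=> x1 x2 /inball[x1r1 _ _ x1h] /inball[x2r1 _ _ x2h].
  have [y1e z1 zeta1 gy1] := loc _ _ x1r1 (Ymin x1).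
  have [y2e z2 zeta2 gy2] := loc _ _ x2r1 (Ymin x2).
  have sub1 := hifbe_argmin_subdiff nu01 gamma0 (Ymin x1).
  have sub2 := hifbe_argmin_subdiff nu01 gamma0 (Ymin x2).
  apply: (argmin_holder nu01 gamma0 hLnu (ltW rho0) rhoc hfgrad z1 z2).
    apply: le_trans (enormB _ _) (le_trans (lerD (ltW x1h) (ltW x2h)) _).
    by rewrite -splitr.
  have b1 : eball 0 eps (Y x1) by rewrite /eball/= subr0.
  have b2 : eball 0 eps (Y x2) by rewrite /eball/= subr0.
  rewrite -[grad f 0]opprK in zeta1 zeta2.
  apply: (prox_ineq_hypomonotone (Ymin x1).1 (Ymin x2).1).
  - exact: prox b1 (frechet_limiting_subdiff sub1) zeta1 gy1 _ b2.
  - exact: prox b2 (frechet_limiting_subdiff sub2) zeta2 gy2 _ b1.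
- move=> x /inball[_ _ xr3 _]; apply: le_trans (opnorm_le_add _ (hessian f 0)) _.
  by rewrite lerD2l ltW// Hnear.
split.
- by move=> x _; rewrite (hifbe_argminE (Ymin x)).
- exact: C1.
- move=> mu Lmu mu0 _ Lmu0 [_ Hmu]; apply: Chol mu0 Lmu0 _ => x y.
  by move=> /inball[_ Ux _ _] /inball[_ Uy _ _]; exact: Hmu.
Qed.
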